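(* Let $K\ge1$, $t_1\in(0,1)$, and let $f$ be the multivariate Gaussian density on $\mathbb{R}^K$ with mean $0$ and positive definite covariance matrix $C$, whose diagonal elements are denoted $\sigma_1^2,\dots,\sigma_K^2$ ($\sigma_k>0$). Let $\mathbf{X}=(X_1,\dots,X_K)'$ have density $f$, let $F_k$ be the c.d.f. of $X_k$, $F(\mathbf{X})=(F_1(X_1),\dots,F_K(X_K))'$, and define the $K\times K$ matrices $$A=\mathbb{E}_f[(F(\mathbf{X})-1/2)\,\nabla\log f(\mathbf{X})'],\qquad \Sigma_{k\ell}=4\operatorname{Cov}(F_k(X_k),F_\ell(X_\ell)).$$ Then $$A=\frac{1}{2\sqrt\pi}\operatorname{diag}(\sigma_1^{-1},\dots,\sigma_K^{-1}),\qquad \Sigma_{k\ell}=\frac{2}{\pi}\arcsin\Big(\frac{C_{k\ell}}{2\sigma_k\sigma_\ell}\Big),\quad 1\le k,\ell\le K.$$ Furthermore, for every $\boldsymbol\delta\in\mathbb{R}^K\setminus\{0\}$, with $$d_S(\boldsymbol\delta)=4t_1(1-t_1)\,\boldsymbol\delta'A'\Sigma^{-1}A\boldsymbol\delta,\qquad d_H(\boldsymbol\delta)=t_1(1-t_1)\,\boldsymbol\delta'C^{-1}\boldsymbol\delta,$$ the asymptotic relative efficiency $d_S(\boldsymbol\delta)/d_H(\boldsymbol\delta)$ satisfies $$\frac{d_S(\boldsymbol\delta)}{d_H(\boldsymbol\delta)}\ \ge\ \frac{3}{\pi}\,\frac{\sigma_{\min}^2}{\sigma_{\max}^2}\,\frac{\lambda_{\min}(C)}{\lambda_{\max}(|C|)},$$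 where $\sigma_{\min}^2$ and $\sigma_{\max}^2$ are the minimal and maximal diagonal terms of $C$, $\lambda_{\min}(C)$ is the minimal eigenvalue of $C$, and $\lambda_{\max}(|C|)$ is the maximal eigenvalue of $|C|=(|C_{k\ell}|)_{1\le k,\ell\le K}$.
   Context: The prime denotes transposition; $F(\mathbf{X})-1/2$ means subtracting $1/2$ from every coordinate. The ratio $d_S(\boldsymbol\delta)/d_H(\boldsymbol\delta)$ is called the asymptotic relative efficiency, with respect to Hotelling's $T^2$ test, of a two-sample homogeneity test based on a quadratic form in the marginal Wilcoxon/Mann--Whitney rank statistics. Here $d_S(\boldsymbol\delta)$ and $d_H(\boldsymbol\delta)$ are the non-centrality parameters of the limiting non-central chi-squared distributions (with $K$ degrees of freedom) of the rank statistic and of Hotelling's statistic respectively, when the first $n_1$ of $n$ independent observations have density $f(\mathbf{x})$, the remaining ones have density $f(\mathbf{x}-\boldsymbol\delta/\sqrt n)$, and $n_1/n\to t_1$ as $n\to\infty$.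
   Formalization: The sign of A is corrected: with A defined by the gradient of log f at X, the value is A = -(1/(2√π)) diag(1/σ_1,...,1/σ_K); for K=1 and standard Gaussian f the printed positive value fails. Σ, d_S, d_H and the lower bound are as printed. *)

(* Defs.v *)
From HB Require Import structures.
From mathcomp Require Import all_boot all_order all_algebra.
From mathcomp Require Import all_classical all_reals all_analysis.
Set Implicit Arguments.
Unset Strict Implicit.
Unset Printing Implicit Defensive.
Import Order.TTheory GRing.Theory Num.Theory.
Import numFieldNormedType.Exports.
Local Open Scope classical_set_scope.
Local Open Scope ring_scope.

(* Lebesgue measure on R^n, i.e., on the product sigma-algebra of n-tuples of
   Borel reals: the Dirac mass on the unique 0-tuple, then iterated products
   with the one-dimensional Lebesgue measure. *)
Section lebesgue_cons.
Context {R : realType} (n : nat).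
Let B := measurableTypeR R.

Definition tuple_cons (p : B * n.-tuple B) : n.+1.-tuple B :=
  [tuple of p.1 :: p.2].

Definition tuple_uncons (t : n.+1.-tuple B) : B * n.-tuple B :=
  (thead t, [tuple of behead t]).

Lemma tuple_unconsK : cancel tuple_uncons tuple_cons.
Proof. by move=> t; rewrite [RHS]tuple_eta. Qed.

Lemma tuple_consK : cancel tuple_cons tuple_uncons.
Proof. by move=> [x t]; congr pair; apply/val_inj. Qed.

Lemma measurable_tuple_cons : measurable_fun setT tuple_cons.
Proof. exact: measurable_cons. Qed.

Lemma measurable_tuple_uncons : measurable_fun setT tuple_uncons.
Proof.
apply: measurable_fun_pair; first exact: measurable_tnth.
apply/measurable_fun_tnthP => i.
rewrite (_ : _ \o _ = fun t : n.+1.-tuple B => tnth t (lift ord0 i)).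
  exact: measurable_tnth.
by apply/funext => t; rewrite /= [in RHS](tuple_eta t) tnthS.
Qed.

Variable m : {sigma_finite_measure set (n.-tuple B) -> \bar R}.

Definition lebesgue_cons : set (n.+1.-tuple B) -> \bar R :=
  pushforward (@lebesgue_measure R \x m)%E tuple_cons.

Let measurable_preimage (A : set (n.+1.-tuple B)) :
  measurable A -> measurable (tuple_cons @^-1` A).
Proof. by move=> mA; rewrite -[X in measurable X]setTI; exact: measurable_tuple_cons. Qed.

Let lebesgue_cons0 : lebesgue_cons set0 = 0%E.
Proof. by rewrite /lebesgue_cons/pushforward preimage_set0 measure0. Qed.

Let lebesgue_cons_ge0 A : (0 <= lebesgue_cons A)%E.
Proof. by rewrite /lebesgue_cons /pushforward; apply: measure_ge0. Qed.

Let lebesgue_cons_sigma_additive : semi_sigma_additive lebesgue_cons.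
Proof.
move=> F mF tF mUF; rewrite /lebesgue_cons /pushforward preimage_bigcup.
apply: measure_semi_sigma_additive.
- by move=> k; exact: measurable_preimage.
- apply/trivIsetP => /= i j _ _ ij; rewrite -preimage_setI.
  by move/trivIsetP : tF => /(_ _ _ _ _ ij) ->//; rewrite preimage_set0.
- by rewrite -preimage_bigcup; exact: measurable_preimage.
Qed.

HB.instance Definition _ := isMeasure.Build _ _ _ lebesgue_cons
  lebesgue_cons0 lebesgue_cons_ge0 lebesgue_cons_sigma_additive.

Let lebesgue_cons_sigma_finite : sigma_finite setT lebesgue_cons.
Proof.
have /sigma_finiteP[F [TF ndF Foo]] := sigma_finiteT (@lebesgue_measure R).
have /sigma_finiteP[G [TG ndG Goo]] := sigma_finiteT m.
exists (fun k => tuple_uncons @^-1` (F k `*` G k)).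
  rewrite -preimage_bigcup (_ : \bigcup_k _ = setT) ?preimage_setT//.
  apply/seteqP; split=> // -[x y] _.
  have [i _ Fix] : (\bigcup_i F i) x by rewrite -TF.
  have [j _ Gjy] : (\bigcup_i G i) y by rewrite -TG.
  exists (maxn i j) => //; split.
  - by move: x Fix; exact/subsetPset/ndF/leq_maxl.
  - by move: y Gjy; exact/subsetPset/ndG/leq_maxr.
move=> k; have [mF Fk] := Foo k; have [mG Gk] := Goo k; split.
  rewrite -[X in measurable X]setTI.
  by apply: measurable_tuple_uncons => //; exact: measurableX.
rewrite /lebesgue_cons /pushforward -comp_preimage.
rewrite (_ : tuple_uncons \o _ = id); last first.
  by apply/funext => p; exact: tuple_consK.
rewrite preimage_id product_measure1E// lte_mul_pinfty//.
by rewrite ge0_fin_numE.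
Qed.

HB.instance Definition _ := Measure_isSigmaFinite.Build _ _ _ lebesgue_cons
  lebesgue_cons_sigma_finite.

End lebesgue_cons.

Fixpoint lebesgue_measure_tuple (R : realType) (n : nat) :
    {sigma_finite_measure set (n.-tuple (measurableTypeR R)) -> \bar R} :=
  match n with
  | 0 => \d_([tuple] : 0.-tuple (measurableTypeR R))
  | n'.+1 => lebesgue_cons (lebesgue_measure_tuple R n')
  end.

Section matrices.
Context {R : realType} {K : nat}.

Definition posdefmx (C : 'M[R]_K) : Prop :=
  C^T = C /\
  forall v : 'cV[R]_K, v != 0 -> 0 < (v^T *m C *m v) ord0 ord0.

(* The spectrum and the diagonal are finite sets, and nonempty when C is
   symmetric and K > 0: the bounds below are then attained, so that they are
   minima and maxima. *)
Definition min_eigenvalue (C : 'M[R]_K) : R := inf [set a | eigenvalue C a].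
Definition max_eigenvalue (C : 'M[R]_K) : R := sup [set a | eigenvalue C a].
Definition min_diag (C : 'M[R]_K) : R := inf (range (fun k => C k k)).
Definition max_diag (C : 'M[R]_K) : R := sup (range (fun k => C k k)).

Definition absmx (C : 'M[R]_K) : 'M[R]_K := \matrix_(k, l) `|C k l|.

Definition gaussian_pdf (C : 'M[R]_K) (x : 'cV[R]_K) : R :=
  (Num.sqrt ((2 * pi) ^+ K * \det C))^-1 *
  expR (- (x^T *m invmx C *m x) ord0 ord0 / 2).

Definition gradient (g : 'cV[R]_K -> R) (x : 'cV[R]_K) : 'cV[R]_K :=
  \col_l 'D_(delta_mx l ord0) g x.

Definition noncentrality_rank (t1 : R) (A Sigma : 'M[R]_K) (delta : 'cV[R]_K)
    : R :=
  4 * t1 * (1 - t1) *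
  (delta^T *m A^T *m invmx Sigma *m A *m delta) ord0 ord0.

Definition noncentrality_hotelling (t1 : R) (C : 'M[R]_K) (delta : 'cV[R]_K)
    : R :=
  t1 * (1 - t1) * (delta^T *m invmx C *m delta) ord0 ord0.

End matrices.

Section random_vector.
Context {R : realType} {K : nat} {d : measure_display} {T : measurableType d}.
Context (P : probability T R) (X : 'I_K -> {RV P >-> R}).

Definition has_density (f : 'cV[R]_K -> R) : Prop :=
  forall B : set (K.-tuple (measurableTypeR R)), measurable B ->
    P [set w | B [tuple X k w | k < K]] =
    (\int[lebesgue_measure_tuple R K]_(t in B) (f (\col_k tnth t k))%:E)%E.

Definition cdf_transform (k : 'I_K) (w : T) : R := fine (cdf (X k) (X k w)).

(* (F(X) - 1/2) (grad (log f) (X))', as a random matrix *)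
Definition score_product (f : 'cV[R]_K -> R) (w : T) : 'M[R]_K :=
  (\col_k (cdf_transform k w - 1 / 2)) *m
  (gradient (fun x => ln (f x)) (\col_k X k w))^T.

Definition score_mx (f : 'cV[R]_K -> R) : 'M[R]_K :=
  \matrix_(k, l) fine 'E_P[fun w => score_product f w k l].

Definition rank_cov_mx : 'M[R]_K :=
  \matrix_(k, l)
    (4 * fine (covariance P (cdf_transform k) (cdf_transform l))).

End random_vector.

(* Main.v *)
Require Import Defs.
From HB Require Import structures.
From mathcomp Require Import all_boot all_order all_algebra.
From mathcomp Require Import all_classical all_reals all_analysis.
From mathcomp Require Import measurable_realfun.
From mathcomp Require Import ring lra.
Set Implicit Arguments.
Unset Strict Implicit.
Unset Printing Implicit Defensive.
Import Order.TTheory GRing.Theory Num.Theory.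
Import numFieldNormedType.Exports.
Local Open Scope classical_set_scope.
Local Open Scope ring_scope.

(** Write [Q = C^-1]; [bform M u v] is the bilinear form [u^T M v].

    The key probabilistic fact ([ge0_integral_residual]) is that, for each
    coordinate [l], the variable [(Q X)_l] is independent of the other
    coordinates of [X] and is normal with variance [Q_ll]. It comes from
    completing the square in [x_l] in the Gaussian density
    ([gaussian_pdf_minor]), once the iterated Lebesgue measure is known to
    allow integrating [x_l] first ([ge0_integral_insert]). Forgetting
    [(Q X)_l] shows that the remaining coordinates form a Gaussian vector again
    ([has_density_minor]); removing coordinates one by one gives the joint law
    of one or two coordinates ([ge0_integral_marginal1],
    [ge0_integral_marginal2]).

    The score of the density is [- Q x]. For [k != l], a bounded function of
    [X_k] is uncorrelated with [(Q X)_l], so [A] is diagonal; and since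
    [X_k = \sum_l C_kl (Q X)_l], its diagonal entries reduce to the
    one-dimensional mean of [(F_k(X_k) - 1/2) X_k].

    All one-dimensional integrals rest on one formula: the standard normal
    distribution function is [1/2 + x * \int_0^1 phi (s x) ds]
    ([normal_prob_Nyc]), [phi] being the density. With it, the covariance of
    two ranks becomes, by Tonelli, a double integral over the unit square of
    second moments of centered Gaussian densities, that is of
    [(1 + s^2 + c^2 t^2)^(-3/2)]; integrating over [s] and [t] yields an arcsine
    ([integral_std_cdfM]). The correlation [rho] enters as
    [c = rho / sqrt (2 - rho^2)], because the mean of [F_l(X_l)] given [X_k] is
    again a normal distribution function ([integral_std_cdf_affine]).

    [Sigma] is invertible because a vector [v] in its kernel would make
    [\sum_k v_k (F_k(X_k) - 1/2)] vanish almost surely, whereas its mean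
    product with [v^T Q X] is a positive combination of the [v_k^2], by the
    computation of [A] ([posdef_rank_cov_mx]).

    For the inequality, convexity of the arcsine on [0, 1/2] gives
    [|Sigma_kl| <= |C_kl| / (3 sigma_k sigma_l)], hence
    [Sigma <= lambda_max |C| / (3 sigma_min^2)] as quadratic forms; the form of
    [Sigma^-1] is then bounded below by Cauchy-Schwarz ([bform_inv_ge]) and
    that of [C^-1] above by [1 / lambda_min C] ([efficiency_ge]). *)


(** * Quadratic forms and extremal eigenvalues *)

Section forms.
Context {R : realType} {K : nat}.
Implicit Types (M C S : 'M[R]_K) (u v w : 'cV[R]_K).

Definition bform M u v : R := (u^T *m M *m v) ord0 ord0.

Lemma bformE M u v : bform M u v = \sum_k \sum_l u k ord0 * M k l * v l ord0.
Proof.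
rewrite /bform -mulmxA mxE; apply: eq_bigr => k _.
by rewrite !mxE big_distrr /=; apply: eq_bigr => l _; rewrite mulrA.
Qed.

Lemma bformDl M u v w : bform M (u + v) w = bform M u w + bform M v w.
Proof. by rewrite /bform linearD /= !mulmxDl mxE. Qed.
Lemma bformDr M u v w : bform M w (u + v) = bform M w u + bform M w v.
Proof. by rewrite /bform mulmxDr mxE. Qed.
Lemma bformZl M a u v : bform M (a *: u) v = a * bform M u v.
Proof. by rewrite /bform linearZ /= -!scalemxAl mxE. Qed.
Lemma bformZr M a u v : bform M u (a *: v) = a * bform M u v.
Proof. by rewrite /bform -scalemxAr mxE. Qed.
Lemma bformC M u v : M^T = M -> bform M u v = bform M v u.
Proof.
move=> sM; rewrite /bform -[in RHS]sM.
rewrite -[LHS]/((u^T *m M *m v) ord0 ord0) -[in LHS](trmxK (u^T *m M *m v)) mxE.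
by rewrite !trmx_mul trmxK mulmxA.
Qed.
Lemma bform_mulr M N u v : bform M u (N *m v) = bform (M *m N) u v.
Proof. by rewrite /bform !mulmxA. Qed.
Lemma bform_delta M k l : bform M (delta_mx k ord0) (delta_mx l ord0) = M k l.
Proof. by rewrite /bform trmx_delta -rowE -colE !mxE. Qed.
Lemma bform1_sum v : bform 1%:M v v = \sum_k v k ord0 ^+ 2.
Proof. by rewrite /bform mulmx1 mxE; apply: eq_bigr => k _; rewrite mxE. Qed.
Lemma bform1_ge0 v : 0 <= bform 1%:M v v.
Proof. by rewrite bform1_sum sumr_ge0// => k _; rewrite sqr_ge0. Qed.
Lemma bform1_gt0 v : v != 0 -> 0 < bform 1%:M v v.
Proof.
move=> v0; rewrite lt_neqAle bform1_ge0 andbT eq_sym bform1_sum.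
apply: contra v0 => /eqP /psumr_eq0P v0; apply/eqP/matrixP => k j.
rewrite mxE (ord1 j); apply/eqP; rewrite -sqrf_eq0.
by rewrite v0// => i _; rewrite sqr_ge0.
Qed.

Lemma bform_le_sum M v :
  bform M v v <= (\sum_k \sum_l `|M k l|) * bform 1%:M v v.
Proof.
rewrite bformE big_distrl /=; apply: ler_sum => k _.
rewrite big_distrl /=; apply: ler_sum => l _.
have vk i : v i ord0 ^+ 2 <= bform 1%:M v v.
  by rewrite bform1_sum (bigD1 i)//= lerDl sumr_ge0// => j _; rewrite sqr_ge0.
rewrite (le_trans (ler_norm _))// mulrAC normrM [leRHS]mulrC ler_wpM2r//.
have := vk k; have := vk l; rewrite -(real_normK (num_real (v k ord0))).
rewrite -(real_normK (num_real (v l ord0))) normrM; nra.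
Qed.

Lemma bform_cauchy_schwarz M u v : M^T = M -> (forall w, 0 <= bform M w w) ->
  bform M u v ^+ 2 <= bform M u u * bform M v v.
Proof.
move=> sM M0; set a := bform M u u; set b := bform M u v; set c := bform M v v.
have p t : 0 <= a + 2 * t * b + t ^+ 2 * c.
  have := M0 (u + t *: v).
  rewrite bformDl !bformDr !bformZl !bformZr (bformC v u sM) -/a -/b -/c.
  by move=> h; apply: le_trans h _; rewrite le_eqVlt; apply/orP; left;
    apply/eqP; ring.
have c0 : 0 <= c by exact: M0.
move: c0; rewrite le_eqVlt => /predU1P[c0|c0]; last first.
  (* the minimum of the quadratic polynomial in [t] *)
  have := p (- b / c); rewrite -(pmulr_rge0 _ c0).
  have -> : c * (a + 2 * (- b / c) * b + (- b / c) ^+ 2 * c) = a * c - b ^+ 2.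
    by field; rewrite gt_eqF.
  by rewrite subr_ge0.
rewrite -c0 mulr0; have [->|b0] := eqVneq b 0; first by rewrite expr0n.
(* a nonconstant affine function of [t] takes the value -1 *)
have := p (- (a + 1) / (2 * b)); rewrite -c0 mulr0 addr0.
have -> : a + 2 * (- (a + 1) / (2 * b)) * b = - 1 by field.
lra.
Qed.

(** Cauchy-Schwarz for [M] between [v] and [M^-1 v]: an upper bound on a
    positive form is a lower bound on the inverse form. *)
Lemma bform_inv_ge M b v : M^T = M -> (forall w, 0 <= bform M w w) ->
  M \in unitmx -> (forall w, bform M w w <= b * bform 1%:M w w) -> 0 < b ->
  bform 1%:M v v <= b * bform (invmx M) v v.
Proof.
move=> sM M0 uM Mb b0; have [->|v0] := eqVneq v 0.
  by rewrite -(scale0r 0) !bformZl !mul0r mulr0.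
have := bform_cauchy_schwarz v (invmx M *m v) sM M0.
rewrite bform_mulr mulmxV//.
have -> : bform M (invmx M *m v) (invmx M *m v) = bform (invmx M) v v.
  by rewrite bform_mulr mulmxV// bformC ?trmx1// bform_mulr mul1mx.
have := bform1_gt0 v0; have := Mb v; have := M0 v.
set N := bform 1%:M v v; set I := bform (invmx M) v v => H1 H2 N0 H3.
have I0 : 0 <= I.
  rewrite leNgt; apply/negP => I0.
  have : N ^+ 2 <= 0 by rewrite (le_trans H3)// mulr_ge0_le0// ltW.
  by rewrite leNgt exprn_gt0.
rewrite -(ler_pM2l N0) -expr2 (le_trans H3)// mulrA [N * b]mulrC.
by rewrite ler_wpM2r.
Qed.

Lemma posdef_unitmx C : posdefmx C -> C \in unitmx.
Proof.
move=> [sC pC]; rewrite -row_free_unit -kermx_eq0; apply/eqP/row_matrixP => i.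
rewrite row0; set r := row i _; have rC : r *m C = 0.
  by rewrite -row_mul mulmx_ker row0.
have [//|r0] := eqVneq r 0; have /pC : r^T != 0 by rewrite trmx_eq0.
by rewrite trmxK rC mul0mx mxE ltxx.
Qed.

Lemma trmx_inv_sym C : C^T = C -> (invmx C)^T = invmx C.
Proof. by move=> sC; rewrite trmx_inv sC. Qed.

Lemma posdef_inv C : posdefmx C -> posdefmx (invmx C).
Proof.
move=> pdC; have uC := posdef_unitmx pdC; have [sC pC] := pdC.
split; first exact: trmx_inv_sym.
move=> v v0; have /pC : invmx C *m v != 0.
  by apply: contraNneq v0 => h; rewrite -(mulKVmx uC v) h mulmx0.
by rewrite trmx_mul trmx_inv_sym// -!mulmxA mulKVmx.
Qed.

Lemma posdef_ge0 C v : posdefmx C -> 0 <= bform C v v.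
Proof.
move=> [_ pC]; have [->|/pC/ltW//] := eqVneq v 0.
by rewrite /bform mulmx0 mxE.
Qed.

Lemma posdef_entry_sqr_le C k l : posdefmx C -> C k l ^+ 2 <= C k k * C l l.
Proof.
move=> pdC; rewrite -!bform_delta.
by apply: bform_cauchy_schwarz pdC.1 _ => w; exact: posdef_ge0.
Qed.

Lemma posdef_diag_gt0 C k : posdefmx C -> 0 < C k k.
Proof.
move=> [_ pC]; rewrite -bform_delta; apply: pC.
by apply/eqP => /matrixP /(_ k ord0); rewrite !mxE !eqxx => /eqP;
  rewrite oner_eq0.
Qed.

Lemma eigenvalue_sym S a : S^T = S -> eigenvalue S a ->
  exists2 v, v != 0 & bform S v v = a * bform 1%:M v v.
Proof.
move=> sS /eigenvalueP[v Sv v0]; exists v^T; first by rewrite trmx_eq0.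
by rewrite /bform trmxK Sv -!scalemxAl mulmx1 mxE.
Qed.

(** The least [mu] with [v^T S v <= mu |v|^2] for all [v] is an eigenvalue:
    otherwise [mu - S] would be nonnegative and invertible, and [bform_inv_ge],
    applied to its inverse, would bound it below by a positive multiple of the
    identity, so that [mu] could be decreased. *)
Lemma bform_le_max_eigenvalue S v : S^T = S ->
  bform S v v <= max_eigenvalue S * bform 1%:M v v.
Proof.
move=> sS; have [->|v0] := eqVneq v 0.
  by rewrite -(scale0r 0) !bformZl !mul0r mulr0.
(* [mu] is the infimum of the upper bounds of the Rayleigh quotient *)
pose U := [set a : R | forall w, bform S w w <= a * bform 1%:M w w].
have Ulb w : w != 0 -> lbound U (bform S w w / bform 1%:M w w).
  by move=> w0 a Ua; rewrite ler_pdivrMr ?bform1_gt0.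
have U0 : U !=set0.
  by exists (\sum_k \sum_l `|S k l|) => w; exact: bform_le_sum.
have hU : has_inf U by split=> //; exists (bform S v v / bform 1%:M v v);
  exact: Ulb.
set mu := inf U.
have Umu : U mu.
  move=> w; have [->|w0] := eqVneq w 0.
    by rewrite -(scale0r 0) !bformZl !mul0r mulr0.
  by rewrite -ler_pdivrMr ?bform1_gt0//; apply: lb_le_inf => //; exact: Ulb.
pose M := mu%:M - S.
have ME w : bform M w w = mu * bform 1%:M w w - bform S w w.
  rewrite /bform mulmxBr mulmxBl [in LHS]mxE [X in _ + X]mxE; congr (_ - _).
  by rewrite mul_mx_scalar -scalemxAl mulmx1 mxE.
have M0 w : 0 <= bform M w w by rewrite ME subr_ge0.
have sM : M^T = M by rewrite linearB /= tr_scalar_mx sS.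
have emu : eigenvalue S mu.
  rewrite /eigenvalue /eigenspace kermx_eq0 row_free_unit.
  have -> : S - mu%:M = - 1 *: M by rewrite scaleN1r opprB.
  rewrite unitmxZ ?unitrN1//; apply/negP => uM.
  have sI := trmx_inv_sym sM.
  set b := \sum_k \sum_l `|invmx M k l|.
  have b1 : 0 < b + 1 by rewrite ltr_wpDl// sumr_ge0// => k _; exact: sumr_ge0.
  have I0 w : 0 <= bform (invmx M) w w.
    rewrite (_ : bform _ w w = bform M (invmx M *m w) (invmx M *m w)) ?M0//.
    by rewrite bform_mulr mulmxV// bformC ?trmx1// bform_mulr mul1mx.
  have /Ulb := v0.
  (* [b] bounds the inverse form; adding 1 makes the bound positive *)
  have : U (mu - (b + 1)^-1).
    move=> w; rewrite mulrBl lerBrDr -lerBrDl -ME mulrC ler_pdivrMr// mulrC.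
    rewrite -(invmxK M); apply: bform_inv_ge => //; first by rewrite unitmx_inv.
    move=> u; rewrite (le_trans (bform_le_sum _ _))// ler_wpM2r ?bform1_ge0//.
    by rewrite lerDl.
  move=> /(ge_inf hU.2) h _; move: h; rewrite -/mu.
  by rewrite lerBrDr gerDl leNgt invr_gt0 b1.
have /le_trans := Umu v; apply; rewrite ler_wpM2r ?bform1_ge0//.
apply: ub_le_sup => //; exists mu => a /= /(eigenvalue_sym sS)[w w0 Sw].
by have := Umu w; rewrite Sw ler_pM2r// bform1_gt0.
Qed.

Lemma bform_ge_min_eigenvalue S v : S^T = S ->
  min_eigenvalue S * bform 1%:M v v <= bform S v v.
Proof.
move=> sS; have sN : (- S)^T = - S by rewrite linearN /= sS.
have := bform_le_max_eigenvalue v sN.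
have -> : bform (- S) v v = - bform S v v.
  by rewrite /bform mulmxN mulNmx mxE.
have -> : max_eigenvalue (- S) = - min_eigenvalue S.
  rewrite /min_eigenvalue /inf opprK; congr sup; apply/seteqP; split=> [a|a].
    move=> /= /eigenvalueP[u uS u0]; exists (- a); last by rewrite opprK.
    by apply/eigenvalueP; exists u => //; rewrite scaleNr -uS mulmxN opprK.
  move=> [b /= /eigenvalueP[u uS u0] <-].
  by apply/eigenvalueP; exists u => //; rewrite scaleNr -uS mulmxN.
by rewrite mulNr lerN2.
Qed.
End forms.

(** * The arcsine near the origin *)

Section arcsine.
Context {R : realType}.
Implicit Type x : R.

Lemma asin0 : asin (0 : R) = 0.
Proof.
rewrite -[X in asin X](@sin0 R) sinK// in_itv/= oppr_le0 andbb.
by rewrite divr_ge0// pi_ge0.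
Qed.

Lemma asinN x : -1 <= x <= 1 -> asin (- x) = - asin x.
Proof.
move=> x1; rewrite -{1}(asinK (x := x)) ?in_itv//= -sinN sinK//.
by rewrite in_itv/= lerN2 lerNl asin_lepi2// asin_geNpi2.
Qed.

(** [s = sin (pi / 6) = cos (pi / 3)] solves [2 s^2 + s - 1 = 0]. *)
Lemma asin_half : asin (1 / 2 : R) = pi / 6.
Proof.
have pi0 : 0 < pi :> R := pi_gt0 R.
rewrite -[RHS]sinK; last by rewrite in_itv/=; apply/andP; split; lra.
congr asin; set s := sin _.
have s0 : 0 < s by apply: sin_gt0_pihalf; apply/andP; split; lra.
have : s = cos (pi / 6 + pi / 6).
  by rewrite /s -cosBpihalf -cosN; congr (cos _); field.
rewrite cosD -!expr2 cos2sin2 -/s => h.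
have /eqP : (2 * s - 1) * (s + 1) = 0.
  by transitivity (s - (1 - s ^+ 2 - s ^+ 2)); [ring|rewrite -h subrr].
rewrite mulf_eq0 => /orP[/eqP|/eqP]; lra.
Qed.

(** Convexity: the mean slope of [asin] over [0, x] is at most its mean slope
    over [x, 1/2]. *)
Lemma asin_le_chord x : 0 <= x <= 1 / 2 -> asin x <= pi / 3 * x.
Proof.
move=> /andP[x0 x2].
have D (a b : R) : 0 <= a -> b <= 1 / 2 -> forall y, y \in `]a, b[ ->
    is_derive y 1 (@asin R) (Num.sqrt (1 - y ^+ 2))^-1.
  move=> a0 b2 y; rewrite in_itv/= => /andP[ay yb].
  by apply: is_derive1_asin; apply/andP; split; lra.
have C (a b : R) : 0 <= a -> b <= 1 / 2 -> {within `[a, b], continuous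
  (@asin R)}.
  move=> a0 b2; apply: continuous_in_subspaceT => y; rewrite inE/= in_itv/=.
  by move=> /andP[ay yb]; apply: continuous_asin; apply/andP; split; lra.
have [c] := MVT_segment x0 (D _ _ (lexx 0) x2) (C _ _ (lexx 0) x2).
rewrite in_itv/= asin0 !subr0 => /andP[c0 cx] e1.
have [c'] := MVT_segment x2 (D _ _ x0 (lexx _)) (C _ _ x0 (lexx _)).
rewrite in_itv/= asin_half => /andP[xc' c'2] e2.
have : (Num.sqrt (1 - c ^+ 2))^-1 <= (Num.sqrt (1 - c' ^+ 2))^-1.
  rewrite lef_pV2 ?posrE ?sqrtr_gt0; [|nra|nra].
  by rewrite ler_sqrt; nra.
rewrite e1; move: e1 e2; set u := (Num.sqrt (1 - c ^+ 2))^-1;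
  set v := (Num.sqrt _)^-1 => e1 e2 uv.
have : u * (x * (1 / 2 - x)) <= v * (x * (1 / 2 - x)).
  by apply: ler_wpM2r => //; rewrite mulr_ge0// subr_ge0.
rewrite mulrA -e1 [v * _]mulrCA -e2; lra.
Qed.

Lemma asin_norm_le x : `|x| <= 1 / 2 -> `|asin x| <= pi / 3 * `|x|.
Proof.
wlog x0 : x / 0 <= x => [h|].
  have [|x0] := leP 0 x; first exact: h.
  rewrite -normrN => xh; rewrite -[`|asin x|]normrN.
  have : -1 <= x <= 1 by move: xh; rewrite gtr0_norm ?oppr_gt0// => ?;
    apply/andP; split; lra.
  by move=> /asinN <-; apply: h => //; rewrite oppr_ge0 ltW.
rewrite (ger0_norm x0) => xh; rewrite ger0_norm ?asin_le_chord ?x0//.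
have pi0 := pi_gt0 R.
rewrite leNgt; apply/negP => a0.
have : sin (- asin x) >= 0.
  apply: sin_ge0_pi; have := @asin_geNpi2 _ x;
    rewrite (le_trans _ x0) ?lerN10//.
  by rewrite (le_trans xh) ?ler_pdivrMr ?mul1r ?ler1n// => /(_ isT) ?;
    apply/andP; split; lra.
rewrite sinN asinK; last by rewrite in_itv/=; apply/andP; split; lra.
rewrite oppr_ge0 => x0'; have xE : x = 0 by apply/eqP; rewrite eq_le x0 x0'.
by move: a0; rewrite xE asin0 ltxx.
Qed.
End arcsine.

(** * Efficiency from an entrywise bound on the rank covariance *)

Section efficiency.
Context {R : realType} {K : nat}.
Variables (C S : 'M[R]_K) (sigma : 'I_K -> R).
Hypothesis pdC : posdefmx C.
Hypothesis hsigma : forall k, 0 < sigma k /\ C k k = sigma k ^+ 2.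

Let sgt0 k : 0 < sigma k. Proof. by have [] := hsigma k. Qed.

Lemma min_diag_le k : min_diag C <= C k k.
Proof.
apply: ge_inf; last by exists k.
by exists 0 => _ [i _ <-]; rewrite ltW// posdef_diag_gt0.
Qed.

Lemma min_diag_gt0 : (0 < K)%N -> 0 < min_diag C.
Proof.
move=> K0; pose i0 := Ordinal K0.
have [i _ hi] := @Order.TotalTheory.arg_minP _ _ _ i0 predT (fun k =>
  C k k) isT.
apply: lt_le_trans (posdef_diag_gt0 i pdC) _.
apply: lb_le_inf; first by exists (C i0 i0), i0.
by move=> _ [k _ <-]; exact: hi.
Qed.

Lemma le_max_diag k : C k k <= max_diag C.
Proof.
apply: ub_le_sup; last by exists k.
have [i _ hi] := @Order.TotalTheory.arg_maxP _ _ _ k predT (fun k => C k k) isT.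
by exists (C i i) => _ [j _ <-]; exact: hi.
Qed.

Let symabs : (absmx C)^T = absmx C.
Proof. by apply/matrixP => k l; rewrite !mxE -[in LHS]pdC.1 mxE. Qed.

Lemma max_eigenvalue_absmx_gt0 : (0 < K)%N -> 0 < max_eigenvalue (absmx C).
Proof.
move=> K0; pose k := Ordinal K0.
have := bform_le_max_eigenvalue (delta_mx k ord0) symabs.
rewrite !bform_delta !mxE eqxx mulr1; apply: lt_le_trans.
by rewrite normr_gt0 gt_eqF// posdef_diag_gt0.
Qed.

Hypothesis K0 : (0 < K)%N.
Hypothesis Sle : forall k l, `|S k l| <= `|C k l| / (3 * sigma k * sigma l).

(** [|v^T S v|] is at most a third of the form of [|C|] at the vector
    [|v_k| / sigma_k], whose squared norm is at most [|v|^2 / min_diag C]. *)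
Lemma bform_rank_cov_le (v : 'cV[R]_K) : bform S v v <=
  max_eigenvalue (absmx C) / (3 * min_diag C) * bform 1%:M v v.
Proof.
pose w : 'cV[R]_K := \col_k (`|v k ord0| / sigma k).
have m0 := min_diag_gt0 K0.
have h1 : bform S v v <= bform (absmx C) w w / 3.
  rewrite !bformE mulr_suml; apply: ler_sum => k _; rewrite mulr_suml.
  apply: ler_sum => l _; rewrite !mxE.
  rewrite (le_trans (ler_norm _))// !normrM.
  have -> : `|v k ord0| / sigma k * `|C k l| * (`|v l ord0| / sigma l) / 3 =
     `|v k ord0| * (`|C k l| / (3 * sigma k * sigma l)) * `|v l ord0|.
    by field; rewrite !gt_eqF.
  by rewrite ler_wpM2r// ler_wpM2l.
have h2 : bform 1%:M w w <= bform 1%:M v v / min_diag C.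
  rewrite !bform1_sum mulr_suml; apply: ler_sum => k _; rewrite mxE.
  rewrite expr_div_n real_normK ?num_real// ler_wpM2l ?sqr_ge0//.
  rewrite lef_pV2 ?posrE ?exprn_gt0//.
  by have [_ <-] := hsigma k; exact: min_diag_le.
apply: (le_trans h1); rewrite ler_pdivrMr//.
apply: (le_trans (bform_le_max_eigenvalue w symabs)).
apply: le_trans (ler_wpM2l (ltW (max_eigenvalue_absmx_gt0 K0)) h2) _.
by rewrite le_eqVlt; apply/orP; left; apply/eqP; field; rewrite gt_eqF.
Qed.

(** Expand [0 <= |v - e w|^2] with [w = C^-1 v] and [e] the least eigenvalue,
    and use [e |w|^2 <= w^T C w = v^T w]. *)
Lemma bform_inv_le (v : 'cV[R]_K) : 0 < min_eigenvalue C ->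
  bform (invmx C) v v <= bform 1%:M v v / min_eigenvalue C.
Proof.
move=> e0; set e := min_eigenvalue C in e0 *.
pose w := invmx C *m v.
have vE : C *m w = v by rewrite mulKVmx// posdef_unitmx.
have hw : bform (invmx C) v v = bform 1%:M v w by rewrite bform_mulr mul1mx.
have : e * bform 1%:M w w <= bform 1%:M v w.
  rewrite (le_trans (bform_ge_min_eigenvalue w pdC.1))//.
  by rewrite -(bformC w v (trmx1 _ _)) -vE bform_mulr mul1mx.
have := bform1_ge0 (v - e *: w).
rewrite -scaleNr bformDl !bformDr !bformZl !bformZr (bformC w v (trmx1 _ _)) hw.
by rewrite ler_pdivlMr//; nra.
Qed.

Hypothesis symS : S^T = S.
Hypothesis S0 : forall v : 'cV[R]_K, 0 <= bform S v v.
Hypothesis unitS : S \in unitmx.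

Lemma efficiency_ge (A : 'M[R]_K) (t1 : R) (delta : 'cV[R]_K) :
  A = - (2 * Num.sqrt pi)^-1 *: diag_mx (\row_k (sigma k)^-1) ->
  0 < t1 < 1 -> delta != 0 ->
  noncentrality_rank t1 A S delta / noncentrality_hotelling t1 C delta >=
  3 / pi * (min_diag C / max_diag C) *
    (min_eigenvalue C / max_eigenvalue (absmx C)).
Proof.
move=> Adef /andP[t0 t1'] d0; pose k0 := Ordinal K0.
have pi0 : 0 < pi :> R := pi_gt0 R.
have m0 := min_diag_gt0 K0; have L0 := max_eigenvalue_absmx_gt0 K0.
have M0 : 0 < max_diag C.
  by rewrite (lt_le_trans _ (le_max_diag k0))// posdef_diag_gt0.
have N0 := bform1_gt0 d0.
set N := bform 1%:M delta delta in N0.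
have tt : 0 < t1 * (1 - t1) by rewrite mulr_gt0// subr_gt0.
have rE : noncentrality_rank t1 A S delta =
    4 * (t1 * (1 - t1)) * bform (invmx S) (A *m delta) (A *m delta).
  by rewrite /noncentrality_rank /bform trmx_mul !mulmxA !mulrA.
have hE : noncentrality_hotelling t1 C delta =
  t1 * (1 - t1) * bform (invmx C) delta delta by [].
have I0 : 0 < bform (invmx C) delta delta by apply: (posdef_inv pdC).2.
have AE : N / (4 * pi * max_diag C) <= bform 1%:M (A *m delta) (A *m delta).
  rewrite /N !bform1_sum mulr_suml; apply: ler_sum => k _.
  rewrite Adef -scalemxAl mul_diag_mx !mxE.
  rewrite [leRHS](_ : _ = delta k ord0 ^+ 2 / (4 * pi * C k k)).
    rewrite ler_wpM2l ?sqr_ge0// lef_pV2 ?posrE ?mulr_gt0 ?posdef_diag_gt0//.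
    by rewrite ler_pM2l ?mulr_gt0// le_max_diag.
  have [_ ->] := hsigma k; rewrite !exprMn sqrrN exprVn exprMn sqr_sqrtr ?ltW//.
  move: (pi : R) pi0 => p p0; field; rewrite !gt_eqF//.
set y := A *m delta in rE AE *.
set b := max_eigenvalue (absmx C) / (3 * min_diag C).
have b0 : 0 < b by rewrite divr_gt0// mulr_gt0.
have Sy : bform 1%:M y y <= b * bform (invmx S) y y.
  by apply: bform_inv_ge => // w; exact: bform_rank_cov_le.
have num : 3 / pi * (min_diag C / max_diag C) / max_eigenvalue (absmx C) * N
    <= 4 * bform (invmx S) y y.
  have := le_trans AE Sy; rewrite -ler_pdivrMl// => h.
  apply: le_trans (ler_wpM2l _ h); last by [].
  rewrite /b; move: (pi : R) pi0 => p p0.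
  by rewrite le_eqVlt; apply/orP; left; apply/eqP; field; rewrite !gt_eqF.
have S1 : 0 <= bform (invmx S) y y.
  by rewrite -(pmulr_rge0 _ b0); exact: le_trans (bform1_ge0 _) Sy.
rewrite rE hE; set c := _ * N in num.
have -> : 4 * (t1 * (1 - t1)) * bform (invmx S) y y /
    (t1 * (1 - t1) * bform (invmx C) delta delta) =
    4 * bform (invmx S) y y / bform (invmx C) delta delta.
  by field; rewrite !gt_eqF// subr_gt0.
rewrite ler_pdivlMr//.
(* for a nonpositive eigenvalue the right-hand side is nonpositive *)
have [e0|e0] := leP (min_eigenvalue C) 0.
  rewrite (@le_trans _ _ 0)//; last by rewrite mulr_ge0.
  apply: mulr_le0_ge0; last exact: ltW.
  apply: mulr_ge0_le0; first by rewrite mulr_ge0 ?divr_ge0// ltW.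
  by rewrite mulr_le0_ge0// invr_ge0 ltW.
apply: le_trans num; rewrite /c.
have := bform_inv_le delta e0; rewrite ler_pdivlMr// -/N => h.
have -> : 3 / pi * (min_diag C / max_diag C) *
    (min_eigenvalue C / max_eigenvalue (absmx C)) * bform (invmx C) delta delta
  = 3 / pi * (min_diag C / max_diag C) / max_eigenvalue (absmx C) *
    (bform (invmx C) delta delta * min_eigenvalue C) by ring.
apply: ler_wpM2l => //; apply: divr_ge0; last exact: ltW.
by apply: mulr_ge0; apply: divr_ge0 => //; exact: ltW.
Qed.
End efficiency.

(** * Densities and affine substitutions in integrals *)

Section density.
Local Open Scope ereal_scope.
Context d (T : measurableType d) (R : realType).

(** The density [f] agrees almost everywhere with the Radon-Nikodym derivative
    of [nu], for which the change of variables is known. *)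
Lemma ge0_integral_density (nu : {finite_measure set T -> \bar R})
    (mu : {sigma_finite_measure set T -> \bar R}) (f : T -> R)
    (g : T -> \bar R) :
  measurable_fun [set: T] f -> (forall x, 0 <= f x)%R ->
  (forall A, measurable A -> nu A = \int[mu]_(x in A) (f x)%:E) ->
  measurable_fun [set: T] g -> (forall x, 0 <= g x) ->
  \int[nu]_x g x = \int[mu]_x (g x * (f x)%:E).
Proof.
move=> mf f0 nuE mg g0.
have mEf : measurable_fun [set: T] (EFin \o f) by exact/measurable_EFinP.
have numu : nu `<< mu.
  apply/null_content_dominatesP => A mA muA0; rewrite nuE//.
  apply: null_set_integral => //; exact: measurable_funTS.
have mh := measurable_int _ (Radon_Nikodym_SigmaFinite.f_integrable numu).
rewrite -(Radon_Nikodym_SigmaFinite.change_of_variables numu)//.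
apply: ge0_ae_eq_integral => //.
- exact: emeasurable_funM.
- exact: emeasurable_funM.
- by move=> x _; rewrite mule_ge0// Radon_Nikodym_SigmaFinite.f_ge0.
- by move=> x _; rewrite mule_ge0// lee_fin.
have : ae_eq mu [set: T] (Radon_Nikodym_SigmaFinite.f nu mu) (EFin \o f).
  apply: integral_ae_eq => //;
    first exact: Radon_Nikodym_SigmaFinite.f_integrable.
  by move=> A _ mA; rewrite -Radon_Nikodym_SigmaFinite.f_integral// nuE.
by apply: filterS => x h Tx; rewrite h.
Qed.
End density.

Section lebesgue_substitution.
Local Open Scope ereal_scope.
Context {R : realType}.
Local Notation mu := (@lebesgue_measure R).
Implicit Types h : R -> \bar R.

(** The image of Lebesgue measure under an affine map is identified by its
    values on half-open intervals. *)
Lemma ge0_integral_shift h (a : R) : measurable_fun [set: R] h ->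
  (forall x, 0 <= h x) -> \int[mu]_x h (x + a)%R = \int[mu]_x h x.
Proof.
move=> mh h0; pose phi (x : R) : measurableTypeR R := (x + a)%R.
have mphi : measurable_fun [set: measurableTypeR R] phi by exact:
  measurable_funD.
pose nu := pushforward mu phi.
transitivity (\int[nu]_x h x).
  by rewrite ge0_integral_pushforward.
apply: eq_measure_integral => /= A mA _; apply/esym.
apply: (@lebesgue_measure_unique R (Measure.clone _ _ _ nu _)) =>
  //= _ [[b c] _ <-].
rewrite /nu /pushforward (_ : phi @^-1` _ = `](b - a)%R, (c - a)%R]%classic).
  rewrite !lebesgue_measure_itv/= !lte_fin ltrD2r; case: ifPn => // _.
  by rewrite -!EFinB; congr EFin; ring.
by apply/seteqP; split=> x /=; rewrite !in_itv/= ltrBlDr lerBrDr.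
Qed.

Lemma ge0_integral_opp h : measurable_fun [set: R] h ->
  (forall x, 0 <= h x) -> \int[mu]_x h (- x)%R = \int[mu]_x h x.
Proof.
move=> mh h0; pose phi : R -> measurableTypeR R := -%R.
have mphi : measurable_fun [set: measurableTypeR R] phi by exact:
  oppr_measurable.
transitivity (\int[pushforward mu phi]_x h x).
  by rewrite ge0_integral_pushforward.
by apply: eq_measure_integral => /= A mA _; exact: lebesgue_measureN.
Qed.

Lemma ge0_integral_scale h (c : R) : c != 0%R -> measurable_fun [set: R] h ->
  (forall x, 0 <= h x) ->
  \int[mu]_x h (c * x)%R = `|c|^-1%:E * \int[mu]_x h x.
Proof.
wlog c0 : h c / (0 < c)%R => [wh|_ mh h0].
  move=> cneq0 mh h0; have [c0|c0] := ltP 0%R c; first exact: wh.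
  have {}c0 : (0 < - c)%R by rewrite oppr_gt0 lt_neqAle cneq0.
  have mhN : measurable_fun [set: R] (fun x => h (- x)%R).
    by apply: measurableT_comp => //; exact: oppr_measurable.
  have := wh (fun x => h (- x)%R) _ c0; rewrite gt_eqF// => /(_ isT mhN).
  rewrite normrN ge0_integral_opp// => <-//.
  by apply: eq_integral => x _; rewrite mulNr opprK.
rewrite gtr0_norm//; pose phi (x : R) : measurableTypeR R := (c * x)%R.
have mphi : measurable_fun [set: measurableTypeR R] phi by exact:
  measurable_funM.
pose nu := pushforward mu phi.
have ci0 : (0 <= c^-1)%R by rewrite invr_ge0 ltW.
pose k := NngNum ci0; have cn0 : (0 <= c)%R := ltW c0; pose k' := NngNum cn0.
transitivity (\int[nu]_x h x).
  by rewrite ge0_integral_pushforward.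
transitivity (\int[mscale k mu]_x h x); last by rewrite ge0_integral_mscale.
apply: eq_measure_integral => /= A mA _.
transitivity (c^-1%:E * (c%:E * nu A)).
  by rewrite /mscale/= muleA -EFinM mulVf ?mul1e// gt_eqF.
rewrite /mscale/=; congr (_ * _); apply/esym.
apply: (@lebesgue_measure_unique R (mscale k'
  (measure_function_pushforward__canonical__measure_function_Measure mu mphi)))
  => //= _ [[a b] _ <-].
rewrite /mscale/= /nu /pushforward (_ : phi @^-1` _ = `](a / c)%R,
  (b / c)%R]%classic).
  rewrite !lebesgue_measure_itv/= !lte_fin ltr_pM2r ?invr_gt0//.
  case: ifPn; rewrite ?mule0// -!EFinB -EFinM => _; congr EFin.
  by field; rewrite gt_eqF.
apply/seteqP; split=> x /=; rewrite !in_itv/= ltr_pdivrMr// ler_pdivlMr//.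
  by rewrite /phi mulrC.
by rewrite /phi mulrC.
Qed.
End lebesgue_substitution.

(** * The standard normal distribution *)

Section standard_normal.
Local Open Scope ereal_scope.
Context {R : realType}.
Local Notation mu := (@lebesgue_measure R).
Local Notation gamma := (@normal_prob R 0 1).
Implicit Types h : R -> \bar R.

Definition std_pdf (x : R) : R := normal_pdf 0 1 x.

Lemma std_pdfE x : std_pdf x = (normal_peak 1 * expR (- x ^+ 2 / 2))%R.
Proof.
by rewrite /std_pdf normal_pdfE ?oner_neq0// /normal_fun subr0 expr1n.
Qed.

Lemma std_pdf_ge0 x : (0 <= std_pdf x)%R. Proof. exact: normal_pdf_ge0. Qed.

Lemma measurable_std_pdf : measurable_fun [set: R] std_pdf.
Proof. exact: measurable_normal_pdf. Qed.

Lemma normal_pdf_scale (s x : R) : (0 < s)%R ->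
  (normal_pdf 0 s (s * x) * s = std_pdf x)%R.
Proof.
move=> s0; rewrite std_pdfE normal_pdfE ?gt_eqF// /normal_fun subr0.
rewrite /normal_peak expr1n mul1r -mulrnAr sqrtrM ?sqr_ge0// sqrtr_sqr
  gtr0_norm//.
have -> : (- (s * x) ^+ 2 / (s ^+ 2 *+ 2) = - x ^+ 2 / 2)%R by field;
  rewrite gt_eqF.
have q0 : (0 < Num.sqrt
  (pi *+ 2 : R))%R by rewrite sqrtr_gt0 mulrn_wgt0// pi_gt0.
by move: (Num.sqrt _) q0 => q q0; field; rewrite !gt_eqF.
Qed.

Lemma ge0_integral_normal_prob (m s : R) h : measurable_fun [set: R] h ->
  (forall x, 0 <= h x) ->
  \int[normal_prob m s]_x h x = \int[mu]_x (h x * (normal_pdf m s x)%:E).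
Proof.
move=> mh h0; apply: ge0_integral_density => //.
- exact: measurable_normal_pdf.
- exact: normal_pdf_ge0.
Qed.

Lemma ge0_integral_std h : measurable_fun [set: R] h -> (forall x, 0 <= h x) ->
  \int[gamma]_x h x = \int[mu]_x (h x * (std_pdf x)%:E).
Proof. exact: ge0_integral_normal_prob. Qed.

Lemma ge0_integral_normal_scale (s : R) h : (0 < s)%R ->
  measurable_fun [set: R] h -> (forall x, 0 <= h x) ->
  \int[mu]_x (h x * (normal_pdf 0 s x)%:E) = \int[gamma]_x h (s * x)%R.
Proof.
move=> s0 mh h0; rewrite ge0_integral_std//; last first.
  by apply: measurableT_comp => //; exact: measurable_funM.
transitivity (s%:E * \int[mu]_x (h (s * x)%R * (normal_pdf 0 s (s * x))%:E)).
  pose g x := h x * (normal_pdf 0 s x)%:E.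
  rewrite (@ge0_integral_scale R g s) ?gt_eqF//; last 2 first.
    apply: emeasurable_funM => //; apply/measurable_EFinP.
    exact: measurable_normal_pdf.
    by move=> x; rewrite mule_ge0// lee_fin normal_pdf_ge0.
  by rewrite gtr0_norm// muleA -EFinM mulfV ?mul1e// gt_eqF.
rewrite -ge0_integralZl//; last 3 first.
- apply: emeasurable_funM.
    by apply: measurableT_comp => //; exact: measurable_funM.
  apply/measurable_EFinP; apply: measurableT_comp.
    exact: measurable_normal_pdf.
  exact: measurable_funM.
- by move=> x _; rewrite mule_ge0// lee_fin normal_pdf_ge0.
- by rewrite lee_fin ltW.
by apply: eq_integral => x _;
  rewrite muleCA -EFinM [(s * normal_pdf _ _ _)%R]mulrC normal_pdf_scale.
Qed.

Lemma std_pdfN (x : R) : std_pdf (- x)%R = std_pdf x.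
Proof. by rewrite !std_pdfE sqrrN. Qed.

Lemma ge0_integral_std_opp h : measurable_fun [set: R] h ->
  (forall x, 0 <= h x) -> \int[gamma]_x h (- x)%R = \int[gamma]_x h x.
Proof.
move=> mh h0; rewrite !ge0_integral_std//; last first.
  by apply: measurableT_comp => //; exact: oppr_measurable.
rewrite -[RHS]ge0_integral_opp.
- by apply: eq_integral => x _; rewrite std_pdfN.
- apply: emeasurable_funM => //; apply/measurable_EFinP;
    exact: measurable_std_pdf.
- by move=> x; rewrite mule_ge0// lee_fin std_pdf_ge0.
Qed.
End standard_normal.

Section second_moment.
Local Open Scope ereal_scope.
Context {R : realType}.
Local Notation mu := (@lebesgue_measure R).
Local Notation gamma := (@normal_prob R 0 1).
Local Notation phi := (@std_pdf R).

Lemma is_derive_std_pdf (x : R) : is_derive x 1%R phi (- x * phi x)%R.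
Proof.
have -> : phi = (fun x => normal_peak 1 * expR (- x ^+ 2 / 2))%R.
  by apply/funext => y; rewrite std_pdfE.
apply: is_derive_eq; rewrite /GRing.scale/= !mulr1.
by field.
Qed.

Lemma continuous_std_pdf : continuous phi.
Proof. by apply: continuous_normal_pdf; rewrite oner_neq0. Qed.

Lemma cvg_std_pdf : phi x @[x --> +oo%R] --> (0 : R)%R.
Proof.
have -> : phi = (fun x => normal_peak 1 * expR (- (2^-1 * x ^+ 2)))%R.
  by apply/funext => y; rewrite std_pdfE; congr (_ * expR _)%R; field.
rewrite -[X in _ --> X](mulr0 (normal_peak (1 : R))%R).
apply: cvgMr; apply: (cvg_comp (fun x => 2^-1 * x ^+ 2)%R (fun x => expR
  (- x))%R).
  by apply: gt0_cvgMry => //; exact: cvgr_expr2.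
exact: cvgr_expR.
Qed.

Lemma integral_tail_id_std_pdf (y : R) : (0 <= y)%R ->
  \int[mu]_(x in `[y, +oo[) (x * phi x)%:E = (phi y)%:E.
Proof.
move=> y0.
rewrite (@ge0_continuous_FTC2y R _ (fun x => - phi x)%R y 0).
- by rewrite sub0e EFinN oppeK.
- by move=> x yx; rewrite mulr_ge0 ?std_pdf_ge0// (le_trans y0).
- apply: continuous_subspaceT => x; apply: cvgM; first exact: cvg_id.
  exact: continuous_std_pdf.
- by rewrite -oppr0; apply: cvgN; exact: cvg_std_pdf.
- by move=> x _; apply: derivableN; apply: ex_derive; exact: is_derive_std_pdf.
- apply: cvg_at_right_filter; apply: cvgN; exact: continuous_std_pdf.
- move=> x _; rewrite derive1E deriveN; last by apply: ex_derive;
    exact: is_derive_std_pdf.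
  by rewrite (@derive_val _ _ _ _ _ _ _ (is_derive_std_pdf x)) mulNr opprK.
Qed.

Lemma integral_half_std_pdf : \int[mu]_(x in `[0%R, +oo[) (phi x)%:E =
  (2^-1)%:E.
Proof.
have := ge0_symfun_integralT (@std_pdf_ge0 R) continuous_std_pdf.
have -> : [set x : R | (0 <= x)%R] = `[0%R, +oo[%classic.
  by apply/seteqP; split => x /=; rewrite in_itv/= andbT.
rewrite integral_normal_pdf => /(_ (fun x => esym (std_pdfN x))) h.
rewrite -[LHS]mul1e -[X in X%:E * _](mulVf (x :=
  2%R)) ?pnatr_eq0// EFinM -muleA.
by rewrite -h mule1.
Qed.

(** [x ^+ 2] is the integral of [x] over [0, x], and [x * std_pdf x] has the
    antiderivative [- std_pdf]; exchanging the two integrals leaves the mass of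
    a half-line. *)
Lemma integral_std_sqr : \int[gamma]_x (x ^+ 2)%:E = 1.
Proof.
rewrite ge0_integral_std; last 2 first.
- by apply/measurable_EFinP; exact: measurable_funX.
- by move=> x; rewrite lee_fin sqr_ge0.
under eq_integral do rewrite -EFinM.
rewrite ge0_symfun_integralT; last 3 first.
- by move=> x; rewrite mulr_ge0 ?sqr_ge0// std_pdf_ge0.
- move=> x; apply: cvgM; first exact: exprn_continuous.
  exact: continuous_std_pdf.
- by move=> x/=; rewrite sqrrN std_pdfN.
have -> : [set x : R | (0 <= x)%R] = `[0%R, +oo[%classic.
  by apply/seteqP; split => x /=; rewrite in_itv/= andbT.
suff -> : \int[mu]_(x in `[0%R, +oo[) (x ^+ 2 * phi x)%:E = (2^-1)%:E.
  by rewrite -EFinM mulfV// pnatr_eq0.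
(* the region under the diagonal, with [x] first and [y] second *)
pose A : set (R * R) := [set p | (0 <= p.2)%R && (p.2 <= p.1)%R].
have mA : measurable A.
  have -> : A = (fun p : R * R => (0 <= p.2)%R &&
    (p.2 <= p.1)%R) @^-1` [set true] by [].
  rewrite -[X in measurable X]setTI.
  have : measurable_fun [set: R * R] (fun p => (0 <= p.2)%R && (p.2 <= p.1)%R).
    apply: measurable_and; apply: measurable_fun_ler => //.
  by apply.
pose f (p : R * R) : \bar R := (\1_A p * (p.1 * phi p.1))%:E.
have mf : measurable_fun [set: R * R] f.
  apply/measurable_EFinP/measurable_funM; first exact: measurable_indic.
  apply: measurable_funM => //; apply: measurableT_comp => //.
  exact: measurable_std_pdf.
have f0 p : 0 <= f p.
  rewrite lee_fin /f indicE; case: (boolP (p \in A)); rewrite ?mul0r//.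
  rewrite inE/= => /andP[p0 p1]; rewrite mul1r mulr_ge0 ?std_pdf_ge0//.
  exact: le_trans p1.
have indA x y : \1_A (x, y) = ((0 <= y)%R && (y <= x)%R)%:R :> R.
  by rewrite indicE; congr (nat_of_bool _)%:R; apply/idP/idP; rewrite inE.
transitivity (\int[mu]_x \int[mu]_y f (x, y)).
  rewrite integral_mkcond; apply: eq_integral => x _; rewrite patchE.
  rewrite mem_setE in_itv/= andbT.
  rewrite (_ : (fun y => f (x, y)) = fun y => (x * phi x * \1_`[0%R, x] y)%:E);
    last first.
    by apply/funext => y; rewrite /f indA mulrC indicE mem_setE in_itv.
  case: ifPn => x0.
    under eq_integral do rewrite EFinM.
    rewrite ge0_integralZl//; last 2 first.
      by apply/measurable_EFinP; exact: measurable_indic.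
      by rewrite lee_fin mulr_ge0// std_pdf_ge0.
    rewrite integral_indic// setIT. rewrite /= lebesgue_measure_itv/= lte_fin.
    case: ifPn => [_|]; first by rewrite -EFinB -EFinM; congr EFin; ring.
    rewrite -leNgt => x0'; have -> : x = 0%R by apply/le_anti; rewrite x0 x0'.
    by rewrite expr0n mul0r mule0.
  rewrite integral0_eq// => y _; rewrite indicE mem_setE in_itv/=.
  have [y0|y0] := leP 0%R y; last by rewrite mulr0.
  by rewrite leNgt (lt_le_trans _ y0) ?mulr0// ltNge.
rewrite fubini_tonelli// -integral_half_std_pdf [RHS]integral_mkcond.
apply: eq_integral => y _; rewrite patchE mem_setE in_itv/= andbT.
case: ifPn => y0; last first.
  by apply: integral0_eq => x _; rewrite /f indA (negbTE y0) mul0r.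
rewrite -integral_tail_id_std_pdf// [RHS]integral_mkcond.
apply: eq_integral => x _; rewrite patchE mem_setE in_itv/= andbT /f indA y0/=.
by case: (y <= x)%R; rewrite ?mul1r ?mul0r.
Qed.
End second_moment.

(** * Averages of the normal density over segments from the origin *)

Section ramp.
Local Open Scope ereal_scope.
Context {R : realType}.
Local Notation mu := (@lebesgue_measure R).
Local Notation gamma := (@normal_prob R 0 1).
Local Notation phi := (@std_pdf R).

(** The mean of the density over the segment from [0] to [x], parametrized by
    [0, 1] so that it makes sense for both signs of [x]. *)
Definition mean_pdf (x : R) : R :=
  fine (\int[mu]_(s in `[0%R, 1%R]) (phi (s * x)%R)%:E).

Lemma std_pdf_le (x : R) : (phi x <= normal_peak 1)%R.
Proof. by apply: normal_pdf_ub; rewrite oner_neq0. Qed.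

Lemma measurable_std_pdf_mul (x : R) (D : set R) :
  measurable_fun D (fun s => (phi (s * x)%R)%:E).
Proof.
apply/measurable_EFinP; apply: measurableT_comp;
  first exact: measurable_std_pdf.
exact: measurable_funM.
Qed.

Lemma mean_pdfE (x : R) :
  \int[mu]_(s in `[0%R, 1%R]) (phi (s * x)%R)%:E = (mean_pdf x)%:E.
Proof.
rewrite fineK// ge0_fin_numE; last first.
  by apply: integral_ge0 => s _; rewrite lee_fin std_pdf_ge0.
apply: (@le_lt_trans _ _ (\int[mu]_(s in `[0%R, 1%R]) (normal_peak
  (1 : R))%:E)).
  apply: ge0_le_integral => //.
  - by move=> s _; rewrite lee_fin std_pdf_ge0.
  - exact: measurable_std_pdf_mul.
  - by move=> s _; rewrite lee_fin std_pdf_le.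
by rewrite integral_cst//= lebesgue_measure_itv/= lte01 oppr0 adde0 mule1 ltry.
Qed.

Lemma mean_pdf_ge0 (x : R) : (0 <= mean_pdf x)%R.
Proof.
by apply: fine_ge0; apply: integral_ge0 => s _; rewrite lee_fin std_pdf_ge0.
Qed.

Lemma mean_pdf_indic (x : R) :
  (mean_pdf x)%:E = \int[mu]_s (\1_`[0%R, 1%R]%classic s * phi (s * x))%:E.
Proof.
rewrite -mean_pdfE integral_mkcond; apply: eq_integral => s _.
by rewrite patchE indicE; case: ifP => _; rewrite ?mul1r ?mul0r.
Qed.

Let measurable_integrand (k : R -> R) (c : R) : measurable_fun [set: R] k ->
  measurable_fun [set: R * R]
    (fun p => (k p.1 * (\1_`[0%R, 1%R]%classic p.2 * phi (p.2 *
      (c * p.1))))%:E).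
Proof.
move=> mk; apply/measurable_EFinP/measurable_funM.
  exact: measurableT_comp.
apply: measurable_funM.
  by apply: measurableT_comp => //; exact: measurable_indic.
apply: measurableT_comp; first exact: measurable_std_pdf.
by apply: measurable_funM => //; exact: measurable_funM.
Qed.

Lemma measurable_mean_pdf : measurable_fun [set: R] mean_pdf.
Proof.
apply/measurable_EFinP.
rewrite (_ : _ \o _ = fubini_F mu (fun p : R * R =>
    (cst 1%R p.1 * (\1_`[0%R, 1%R]%classic p.2 * phi (p.2 * (1 * p.1))))%:E)).
  apply: measurable_fun_fubini_tonelli_F; first exact: measurable_integrand.
  by move=> p; rewrite lee_fin /cst !mulr_ge0 ?std_pdf_ge0 ?ler01// indicE
    ler0n.
apply/funext => x; rewrite /fubini_F/= mean_pdf_indic;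
  apply: eq_integral => s _.
by rewrite !mul1r.
Qed.

(** Tonelli's theorem: the mean over the segment can be taken last. *)
Lemma ge0_integral_mean_pdf (k : R -> R) (c : R) : measurable_fun [set: R] k ->
  (forall x, 0 <= k x)%R ->
  \int[mu]_x (k x * mean_pdf (c * x))%:E =
  \int[mu]_(t in `[0%R, 1%R]) \int[mu]_x (k x * phi (t * (c * x)))%:E.
Proof.
move=> mk k0; have mI := measurable_integrand c mk.
set f := (X in measurable_fun _ X) in mI.
have f0 p : 0 <= f p.
  by rewrite lee_fin !mulr_ge0 ?std_pdf_ge0// indicE ler0n.
transitivity (\int[mu]_x \int[mu]_s f (x, s)).
  apply: eq_integral => x _; rewrite EFinM mean_pdf_indic -ge0_integralZl//.
  - apply/measurable_EFinP/measurable_funM; first exact: measurable_indic.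
    by apply/measurable_EFinP; exact: measurable_std_pdf_mul.
  - by move=> s _; rewrite lee_fin mulr_ge0 ?std_pdf_ge0// indicE ler0n.
  - by rewrite lee_fin.
rewrite fubini_tonelli// [RHS]integral_mkcond; apply: eq_integral => s _ /=.
rewrite patchE /f /= indicE; case: ifP => _.
  by apply: eq_integral => x _; rewrite mul1r.
by apply: integral0_eq => x _; rewrite mul0r mulr0.
Qed.

Lemma integral_sqr_std_pdf_scale (r : R) : (0 < r)%R ->
  \int[mu]_x (x ^+ 2 * phi (r * x))%:E = ((r ^+ 3)^-1)%:E.
Proof.
move=> r0; pose h y := ((y / r) ^+ 2 * phi y)%:E.
have mh : measurable_fun [set: R] h.
  apply/measurable_EFinP/measurable_funM; last exact: measurable_std_pdf.
  by apply: measurable_funX; exact: measurable_funM.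
have h0 y : 0 <= h y by rewrite lee_fin mulr_ge0 ?sqr_ge0 ?std_pdf_ge0.
transitivity (\int[mu]_x h (r * x)%R).
  by apply: eq_integral => x _;
    rewrite /h [(r * x / r)%R]mulrAC mulfV ?mul1r// gt_eqF.
rewrite ge0_integral_scale ?gt_eqF// gtr0_norm//.
transitivity (r^-1%:E * \int[mu]_y ((r ^- 2)%:E * ((y ^+ 2)%:E * (phi y)%:E))).
  congr (_ * _); apply: eq_integral => y _; rewrite /h -!EFinM; congr EFin.
  by rewrite expr_div_n mulrAC mulrC.
rewrite ge0_integralZl//; last 3 first.
- apply: emeasurable_funM; apply/measurable_EFinP; first exact: measurable_funX.
  exact: measurable_std_pdf.
- by move=> y _; rewrite -EFinM lee_fin mulr_ge0 ?sqr_ge0 ?std_pdf_ge0.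
- by rewrite lee_fin invr_ge0 sqr_ge0.
rewrite -ge0_integral_std ?integral_std_sqr ?mule1.
- by rewrite -EFinM; congr EFin; field; rewrite gt_eqF.
- by apply/measurable_EFinP; exact: measurable_funX.
- by move=> y; rewrite lee_fin sqr_ge0.
Qed.

Lemma integral01_is_derive (F f : R -> R) :
  (forall s : R, is_derive s 1%R F (f s)) -> continuous f ->
  \int[mu]_(s in `[0%R, 1%R]) (f s)%:E = (F 1 - F 0)%:E.
Proof.
move=> dF cf.
have cF : continuous F.
  move=> s; apply/differentiable_continuous/derivable1_diffP.
  exact: (@ex_derive _ _ _ _ _ _ _ (dF s)).
rewrite (@continuous_FTC2 R f F 0 1)//.
- exact: continuous_subspaceT.
- split.
  + by move=> x _; exact: (@ex_derive _ _ _ _ _ _ _ (dF x)).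
  + by apply: cvg_at_right_filter; exact: cF.
  + by apply: cvg_at_left_filter; exact: cF.
- by move=> x _; rewrite derive1E (@derive_val _ _ _ _ _ _ _ (dF x)).
Qed.

Lemma is_derive_sqrt_quad (a b s : R) : (0 < a)%R -> (0 <= b)%R ->
  is_derive s 1%R (fun s : R => Num.sqrt (a + b * s ^+ 2))%R
    (b * s / Num.sqrt (a + b * s ^+ 2))%R.
Proof.
move=> a0 b0; have p0 : (0 < a + b * s ^+ 2)%R.
  by rewrite ltr_pwDl// mulr_ge0// sqr_ge0.
have q0 : (0 < Num.sqrt (a + b * s ^+ 2))%R by rewrite sqrtr_gt0.
have dg : is_derive s 1%R (fun s : R => a + b * s ^+ 2)%R (2 * b * s)%R.
  by apply: is_derive_eq; rewrite /GRing.scale/=; ring.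
have ds := is_derive1_sqrt p0.
have := @is_derive1_comp _ (@Num.sqrt R) (fun s =>
  a + b * s ^+ 2)%R s _ _ ds dg.
move=> h; apply: (is_derive_eq h).
by field; rewrite gt_eqF.
Qed.

Lemma continuous_sqrt_quad (a b : R) : (0 < a)%R -> (0 <= b)%R ->
  continuous (fun s : R => Num.sqrt (a + b * s ^+ 2))%R.
Proof.
move=> a0 b0 s; apply/differentiable_continuous/derivable1_diffP.
exact: (@ex_derive _ _ _ _ _ _ _ (is_derive_sqrt_quad s a0 b0)).
Qed.

(** The antiderivative is [s / (a * sqrt (a + s^2))]. *)
Lemma integral_cube_sqrt (a : R) : (0 < a)%R ->
  \int[mu]_(s in `[0%R, 1%R]) ((Num.sqrt (a + s ^+ 2) ^+ 3)^-1)%:E =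
  (a * Num.sqrt (a + 1))^-1%:E.
Proof.
move=> a0; pose q (s : R) := Num.sqrt (a + 1 * s ^+ 2).
have p0 (s : R) : (0 < a + 1 * s ^+ 2)%R by rewrite ltr_pwDl// mul1r sqr_ge0.
have q0 (s : R) : (0 < q s)%R by rewrite sqrtr_gt0.
have q2 (s : R) : (q s ^+ 2 =
  a + s ^+ 2)%R by rewrite sqr_sqrtr ?mul1r// -[X in (_ <= a + X)%R]mul1r ltW.
have cq : continuous q by exact: continuous_sqrt_quad.
pose F s := (a^-1 * (s * (q s)^-1))%R.
under eq_integral => s _ do rewrite -[X in (a + X)%R]mul1r -/(q s).
have dF (s : R) : is_derive s 1%R F (q s ^+ 3)^-1%R.
  have dq : is_derive s 1%R q (1 * s / q s)%R by exact: is_derive_sqrt_quad.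
  have dV := is_deriveV (lt0r_neq0 (q0 s)) dq.
  rewrite /F; apply: is_derive_eq; rewrite /GRing.scale/=.
  have := q2 s; move: (q s) (q0 s) => r r0 r2.
  have -> : a = (r ^+ 2 - s ^+ 2)%R by rewrite r2 addrK.
  field; rewrite gt_eqF//= subr_eq0 -subr_eq0 r2 addrK gt_eqF//.
have cf : continuous (fun s => (q s ^+ 3)^-1)%R.
  move=> s; apply: cvgV; first by rewrite expf_neq0// gt_eqF.
  by apply: (cvg_comp q (fun x => x ^+ 3)%R);
    [exact: cq|exact: exprn_continuous].
have -> := integral01_is_derive dF cf.
by rewrite /F mul0r mulr0 subr0 mul1r /q expr1n mulr1 invfM.
Qed.

Lemma measurable_inv_cube_sqrt (a : R) (D : set R) : (0 < a)%R ->
  measurable_fun D (fun s : R => (Num.sqrt (a + s ^+ 2) ^+ 3)^-1)%R.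
Proof.
move=> a0; apply: measurable_funTS; apply: continuous_measurable_fun.
rewrite (_ : (fun _ => _) =
    fun s : R => (Num.sqrt (a + 1 * s ^+ 2) ^+ 3)^-1%R); last first.
  by apply/funext => s; rewrite mul1r.
move=> s; apply: cvgV.
  by rewrite expf_neq0// gt_eqF// sqrtr_gt0 ltr_pwDl// mul1r sqr_ge0.
apply: (cvg_comp (fun s => Num.sqrt (a + 1 * s ^+ 2))%R (fun x => x ^+ 3)%R).
  exact: continuous_sqrt_quad.
exact: exprn_continuous.
Qed.

(** The antiderivative is [asin (c t / sqrt (2 (1 + c^2 t^2)))]. *)
Lemma integral_asin_kernel (c : R) :
  \int[mu]_(t in `[0%R, 1%R])
     (c / ((1 + (t * c) ^+ 2) * Num.sqrt (1 + (t * c) ^+ 2 + 1)))%:E =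
  (asin (c / (Num.sqrt 2 * Num.sqrt (1 + c ^+ 2))))%:E.
Proof.
pose q (t : R) : R := Num.sqrt (1 + c ^+ 2 * t ^+ 2)%R.
pose w (t : R) : R := (c * (t * (Num.sqrt 2 * q t)^-1))%R.
have c0 : (0 <= c ^+ 2)%R by rewrite sqr_ge0.
have p0 (t : R) : (0 < 1 + c ^+ 2 * t ^+ 2)%R by rewrite ltr_pwDl// mulr_ge0
  ?sqr_ge0.
have q0 (t : R) : (0 < q t)%R by rewrite sqrtr_gt0.
have q2 (t : R) : (q t ^+ 2 = 1 + c ^+ 2 * t ^+ 2)%R by rewrite sqr_sqrtr// ltW.
have s0 : (0 < Num.sqrt 2 :> R)%R by rewrite sqrtr_gt0.
have s2 : (Num.sqrt 2 ^+ 2 = 2 :> R)%R by rewrite sqr_sqrtr.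
have w2 t : (1 - w t ^+ 2 = (1 + (t * c) ^+ 2 + 1) / (2 * q t ^+ 2))%R.
  rewrite /w exprMn exprMn exprVn exprMn s2 q2; field.
  by rewrite exprMn gt_eqF.
have wlt t : (-1 < w t < 1)%R.
  rewrite -ltr_norml -(ltr_pXn2r (n := 2))// ?nnegrE// real_normK ?num_real//.
  rewrite expr1n -subr_gt0 w2 divr_gt0 ?mulr_gt0 ?exprn_gt0//.
  by rewrite addr_gt0// ltr_pwDl// sqr_ge0.
have dF (t : R) : is_derive t 1%R (asin \o w)
    (c / ((1 + (t * c) ^+ 2) * Num.sqrt (1 + (t * c) ^+ 2 + 1)))%R.
  have dq : is_derive t 1%R q
    (c ^+ 2 * t / q t)%R by exact: is_derive_sqrt_quad.
  have dq2 : is_derive t 1%R (fun t => Num.sqrt 2 * q t)%R (Num.sqrt 2 *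
    (c ^+ 2 * t / q t))%R.
    by apply: is_derive_eq; rewrite /GRing.scale/=; ring.
  have dV := is_deriveV (f := fun t : R => (Num.sqrt 2 * q t)%R)
    (lt0r_neq0 (mulr_gt0 s0 (q0 t))) dq2.
  have dw : is_derive t 1%R w (c / (Num.sqrt 2 * q t ^+ 3))%R.
    rewrite /w; apply: is_derive_eq; rewrite /GRing.scale/=.
    have : (c ^+ 2 * t ^+ 2 = q t ^+ 2 - 1)%R by rewrite q2 addrC addKr.
    move: (q t) (q0 t) => r r0 r2.
    have -> : (t * (- (Num.sqrt 2 * r) ^- 2 * (Num.sqrt 2 *
      (c ^+ 2 * t / r))))%R =
      (- (c ^+ 2 * t ^+ 2) / (Num.sqrt 2 * r ^+ 3))%R by field; rewrite !gt_eqF.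
    by rewrite r2; field; rewrite !gt_eqF.
  have h := is_derive1_comp (is_derive1_asin (wlt t)) dw.
  apply: (is_derive_eq h).
  rewrite w2.
  have -> : (1 + (t * c) ^+ 2 = q t ^+ 2)%R by rewrite q2 exprMn mulrC.
  move: (q t) (q0 t) => r r0.
  have v0 : (0 < Num.sqrt
    (r ^+ 2 + 1))%R by rewrite sqrtr_gt0 ltr_pwDr// sqr_ge0.
  have -> : Num.sqrt ((r ^+ 2 + 1) / (2 * r ^+ 2)) =
      (Num.sqrt (r ^+ 2 + 1) / (Num.sqrt 2 * r))%R.
    have sr : (Num.sqrt (r ^+ 2) = r)%R by rewrite sqrtr_sqr gtr0_norm.
    have r1 : (0 <= r ^+ 2 + 1)%R by rewrite addr_ge0// sqr_ge0.
    have r2 : (0 <= 2 * r ^+ 2)%R by rewrite mulr_ge0// sqr_ge0.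
    by rewrite (sqrtrM _ r1) (sqrtrV r2) (sqrtrM _ (ler0n R 2)) sr.
  by move: (Num.sqrt (r ^+ 2 + 1))%R v0 => v v0; field; rewrite !gt_eqF.
have cf : continuous (fun t : R => c / ((1 + (t * c) ^+ 2) * Num.sqrt (1 +
  (t * c) ^+ 2 + 1)))%R.
  have -> : (fun t : R => c / ((1 + (t * c) ^+ 2) * Num.sqrt (1 +
    (t * c) ^+ 2 + 1)))%R =
    (fun t : R => c * (q t ^+ 2 * Num.sqrt (2 + c ^+ 2 * t ^+ 2))^-1)%R.
    apply/funext => t; rewrite q2 exprMn [(t ^+ 2 * _)%R]mulrC.
    by congr (_ / (_ * Num.sqrt _))%R; ring.
  move=> t; apply: cvgMr; apply: cvgV.
    by rewrite gt_eqF// mulr_gt0 ?exprn_gt0// sqrtr_gt0 ltr_pwDl// mulr_ge0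
      ?sqr_ge0.
  apply: cvgM; last exact: continuous_sqrt_quad.
  apply: (cvg_comp q (fun x => x ^+ 2)%R); last exact: exprn_continuous.
  exact: continuous_sqrt_quad.
have -> := integral01_is_derive dF cf.
by rewrite /= /w !mul0r !mulr0 asin0 subr0 mul1r /q expr1n mulr1.
Qed.
End ramp.

(** * The normal distribution function *)

Section normal_cdf.
Local Open Scope ereal_scope.
Context {R : realType}.
Local Notation mu := (@lebesgue_measure R).
Local Notation gamma := (@normal_prob R 0 1).
Local Notation phi := (@std_pdf R).

Definition std_cdf (x : R) : R := (1 / 2 + x * mean_pdf x)%R.

Lemma mean_pdfN (x : R) : mean_pdf (- x) = mean_pdf x.
Proof.
by congr fine; apply: eq_integral => s _; rewrite mulrN std_pdfN.
Qed.

Lemma std_cdfN (x : R) : (std_cdf (- x) = 1 - std_cdf x)%R.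
Proof. by rewrite /std_cdf mean_pdfN; field. Qed.

Lemma measurable_std_cdf : measurable_fun [set: R] std_cdf.
Proof.
apply: measurable_funD => //; apply: measurable_funM => //.
exact: measurable_mean_pdf.
Qed.

Lemma normal_prob_indic (A : set R) : measurable A ->
  gamma A = \int[mu]_x (\1_A x * phi x)%:E.
Proof.
move=> mA; rewrite -[in LHS](setIT A) -integral_indic// ge0_integral_std//.
exact/measurable_EFinP/measurable_indic.
Qed.

(** The substitution [y = x s]; the absolute value makes it valid for both signs
    of [x]. *)
Lemma integral_indic_std_pdf_scale (x : R) (A : set R) : x != 0%R ->
  measurable A ->
  (\int[mu]_y (\1_A y * phi y)%:E =
   `|x|%:E * \int[mu]_s (\1_A (x * s) * phi (s * x))%:E)%E.
Proof.
move=> x0 mA; have m1 : measurable_fun [set: R] (fun y => (\1_A y * phi y)%:E).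
  apply/measurable_EFinP/measurable_funM; last exact: measurable_std_pdf.
  exact: measurable_indic.
have -> : \int[mu]_s (\1_A (x * s) * phi (s * x))%:E =
    \int[mu]_s (\1_A (x * s) * phi (x * s))%:E.
  by apply: eq_integral => s _; rewrite [(s * x)%R]mulrC.
rewrite (ge0_integral_scale x0 m1); last first.
  by move=> y; rewrite lee_fin mulr_ge0 ?std_pdf_ge0// indicE ler0n.
by rewrite muleA -EFinM mulfV ?mul1e// normr_eq0.
Qed.

Lemma normal_prob_Nyc0 : gamma `]-oo, 0%R] = (2^-1)%:E.
Proof.
rewrite normal_prob_indic// -ge0_integral_opp; last 2 first.
- apply/measurable_EFinP/measurable_funM; last exact: measurable_std_pdf.
  exact: measurable_indic.
- by move=> y; rewrite lee_fin mulr_ge0 ?std_pdf_ge0// indicE ler0n.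
rewrite -integral_half_std_pdf [RHS]integral_mkcond.
apply: eq_integral => s _;
  rewrite patchE indicE !mem_setE !in_itv/= oppr_le0 andbT.
by rewrite std_pdfN; case: ifP => _; rewrite ?mul1r ?mul0r.
Qed.

(** The interval between [0] and [x] is [x] times the unit interval, so its mass
    is [|x| * mean_pdf x], to be added to or removed from [1 / 2]. *)
Lemma normal_prob_Nyc (x : R) : gamma `]-oo, x] = (std_cdf x)%:E.
Proof.
have [x0|x0|->] := ltgtP x 0%R;
  last by rewrite normal_prob_Nyc0 /std_cdf mul0r addr0 div1r.
- have : gamma `]-oo, 0%R] = gamma `]-oo, x] + gamma `]x, 0%R].
    rewrite -measureU//; last first.
      apply/seteqP; split => // y []/=; rewrite !in_itv/= => yx /andP[xy _].
      by move: (lt_le_trans xy yx); rewrite ltxx.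
    by congr (gamma _); rewrite -itv_bndbnd_setU// bnd_simp// ltW.
  rewrite normal_prob_Nyc0 => h.
  have : gamma `]x, 0%R] = (- x * mean_pdf x)%:E.
    rewrite normal_prob_indic//
      (@integral_indic_std_pdf_scale x) ?lt_eqF// ltr0_norm//.
    rewrite EFinM; congr (_ * _); rewrite -mean_pdfE.
    rewrite -integral_itv_bndo_bndc//; last exact: measurable_std_pdf_mul.
    rewrite [RHS]integral_mkcond; apply: eq_integral => s _.
    rewrite patchE indicE !mem_setE !in_itv/= nmulr_rle0//.
    rewrite -[X in (X < _)%R]mulr1 ltr_nM2l// andbC.
    by case: ifP => _; rewrite ?mul1r ?mul0r.
  move=> h'; move: h; rewrite h'; case: (gamma _) => [r| |]//= [h].
  by congr EFin; rewrite /std_cdf div1r h; ring.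
- have -> : gamma `]-oo, x] = gamma `]-oo, 0%R] + gamma `]0%R, x].
    rewrite -measureU//; last first.
      apply/seteqP; split => // y []/=; rewrite !in_itv/= => yx /andP[xy _].
      by move: (lt_le_trans xy yx); rewrite ltxx.
    by congr (gamma _); rewrite -itv_bndbnd_setU// bnd_simp// ltW.
  rewrite normal_prob_Nyc0 /std_cdf EFinD div1r; congr (_ + _).
  rewrite normal_prob_indic//
    (@integral_indic_std_pdf_scale x) ?gt_eqF// gtr0_norm//.
  rewrite EFinM; congr (_ * _); rewrite -mean_pdfE.
  rewrite -integral_itv_obnd_cbnd//; last exact: measurable_std_pdf_mul.
  rewrite [RHS]integral_mkcond; apply: eq_integral => s _.
  rewrite patchE indicE !mem_setE !in_itv/= pmulr_rgt0//.
  rewrite -[X in (_ <= X)%R]mulr1 ler_pM2l//.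
  by case: ifP => _; rewrite ?mul1r ?mul0r.
Qed.

Lemma std_cdf_ge0 (x : R) : (0 <= std_cdf x)%R.
Proof. by rewrite -lee_fin -normal_prob_Nyc. Qed.

Lemma std_cdf_le1 (x : R) : (std_cdf x <= 1)%R.
Proof. by rewrite -lee_fin -normal_prob_Nyc; exact: probability_le1. Qed.
End normal_cdf.

(** * Gaussian integrals of the distribution function *)

Section gaussian_integrals.
Local Open Scope ereal_scope.
Context {R : realType}.
Local Notation mu := (@lebesgue_measure R).
Local Notation gamma := (@normal_prob R 0 1).
Local Notation phi := (@std_pdf R).
Local Notation P := (@normal_peak R 1).

Lemma normal_peak1_sqr : (P ^+ 2 = (2 * pi)^-1)%R.
Proof.
rewrite /normal_peak expr1n mul1r exprVn sqr_sqrtr ?mulr_natl//.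
by rewrite mulrn_wge0// pi_ge0.
Qed.

Lemma normal_peak1 : (P = (Num.sqrt 2 * Num.sqrt pi)^-1)%R.
Proof. by rewrite /normal_peak expr1n mul1r -mulr_natl sqrtrM. Qed.

(** Products of densities are, up to a constant, a density at another scale, so
    that all the integrals below reduce to the second moment of one normal
    distribution. *)
Lemma std_pdf_mul (u v w : R) : (w ^+ 2 = u ^+ 2 + v ^+ 2)%R ->
  (phi u * phi v = P * phi w)%R.
Proof.
move=> h; rewrite !std_pdfE h mulrACA -expRD mulrA; congr (_ * expR _)%R.
by field.
Qed.

Let msqr : measurable_fun [set: R] (fun x : R => x ^+ 2)%R.
Proof. exact: measurable_funX. Qed.

Let mpdf : measurable_fun [set: R] phi. Proof. exact: measurable_std_pdf. Qed.
Let mmean : measurable_fun [set: R] (@mean_pdf R).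
Proof. exact: measurable_mean_pdf. Qed.

Let ge0_integral_Zl (p : R) (f : R -> R) : (0 <= p)%R ->
  measurable_fun [set: R] f ->
  (forall x, 0 <= f x)%R -> \int[mu]_x (p * f x)%:E = p%:E * \int[mu]_x
    (f x)%:E.
Proof.
move=> p0 mf f0; under eq_integral do rewrite EFinM.
rewrite ge0_integralZl//; last by move=> x _; rewrite lee_fin.
exact/measurable_EFinP.
Qed.

Lemma integral_std_sqr_mean_pdf :
  \int[gamma]_x (x ^+ 2 * mean_pdf x)%:E = (2 * Num.sqrt pi)^-1%:E.
Proof.
rewrite ge0_integral_std; last 2 first.
- by apply/measurable_EFinP; exact: measurable_funM.
- by move=> x; rewrite lee_fin mulr_ge0 ?sqr_ge0 ?mean_pdf_ge0.
transitivity (\int[mu]_x ((x ^+ 2 * phi x) * mean_pdf (1 * x))%:E).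
  by apply: eq_integral => x _; rewrite mul1r -EFinM mulrAC.
rewrite ge0_integral_mean_pdf; last 2 first.
- exact: measurable_funM.
- by move=> x; rewrite mulr_ge0 ?sqr_ge0 ?std_pdf_ge0.
have P0 : (0 <= P)%R by exact: normal_peak_ge0.
transitivity (\int[mu]_(s in `[0%R, 1%R]) (P%:E * ((Num.sqrt
  (1 + s ^+ 2) ^+ 3)^-1)%:E)).
  apply: eq_integral => s _; set r := Num.sqrt (1 + s ^+ 2).
  have r0 : (0 < r)%R by rewrite sqrtr_gt0 ltr_pwDl// sqr_ge0.
  have r2 : (r ^+ 2 = 1 + s ^+ 2)%R by rewrite sqr_sqrtr// addr_ge0// sqr_ge0.
  rewrite -integral_sqr_std_pdf_scale// -ge0_integral_Zl//; last 2 first.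
  - apply: measurable_funM => //; apply: (measurableT_comp mpdf).
    exact: measurable_funM.
  - by move=> x; rewrite mulr_ge0 ?sqr_ge0 ?std_pdf_ge0.
  apply: eq_integral => x _; congr EFin.
  rewrite mul1r -mulrA (@std_pdf_mul _ _ (r * x)) 1?mulrCA//.
  by rewrite exprMn r2; ring.
rewrite ge0_integralZl//; last first.
  by apply/measurable_EFinP; exact: measurable_inv_cube_sqrt.
rewrite integral_cube_sqrt// -EFinM normal_peak1; congr EFin.
rewrite (_ : 1 + 1 = 2)%R; last by ring.
have s0 : (0 < Num.sqrt 2 :> R)%R by rewrite sqrtr_gt0.
have p0 : (0 < Num.sqrt pi :> R)%R by rewrite sqrtr_gt0 pi_gt0.
have : (Num.sqrt 2 ^+ 2 = 2 :> R)%R by rewrite sqr_sqrtr.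
move: (Num.sqrt 2) (Num.sqrt pi) s0 p0 => u v u0 v0 <-.
by field; rewrite !gt_eqF.
Qed.

Lemma integral_std_abs_lty : \int[gamma]_x `|x|%:E < +oo.
Proof.
apply: (@le_lt_trans _ _ (\int[gamma]_x (cst 1 x + (x ^+ 2)%:E))).
  apply: ge0_le_integral => //.
  - by apply/measurable_EFinP; exact: normr_measurable.
  - apply: emeasurable_funD; first exact: measurable_cst.
    by apply/measurable_EFinP.
  - move=> x _; rewrite /cst -EFinD lee_fin -(real_normK (num_real x)).
    have := sqr_ge0 (`|x| - 1)%R; rewrite sqrrB expr1n mulr1.
    have := normr_ge0 x; lra.
rewrite ge0_integralD//; last 2 first.
- by move=> x _; rewrite lee_fin sqr_ge0.
- exact/measurable_EFinP.
rewrite integral_std_sqr integral_cst//. rewrite /= probability_setT mule1.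
by rewrite -EFinD ltry.
Qed.
End gaussian_integrals.

Section gaussian_cdf_integrals.
Local Open Scope ereal_scope.
Context {R : realType}.
Local Notation mu := (@lebesgue_measure R).
Local Notation gamma := (@normal_prob R 0 1).
Local Notation phi := (@std_pdf R).
Local Notation P := (@normal_peak R 1).

Let mpdf : measurable_fun [set: R] phi. Proof. exact: measurable_std_pdf. Qed.
Let mcdf : measurable_fun [set: R] (@std_cdf R).
Proof. exact: measurable_std_cdf. Qed.
Let mmean : measurable_fun [set: R] (@mean_pdf R).
Proof. exact: measurable_mean_pdf. Qed.

Let ereal_half (y : \bar R) (r : R) : y + y = r%:E -> y = (r / 2)%:E.
Proof. by case: y => [s| |]//= [h]; congr EFin; lra. Qed.

Lemma integral_std_cdf : \int[gamma]_x (std_cdf x)%:E = (1 / 2)%:E.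
Proof.
have mE : measurable_fun [set: R] (fun x =>
  (std_cdf x)%:E) by exact/measurable_EFinP.
have h0 (x : R) : 0 <= (std_cdf x)%:E by rewrite lee_fin std_cdf_ge0.
have hN := ge0_integral_std_opp mE h0.
have : \int[gamma]_x (std_cdf x)%:E + \int[gamma]_x (std_cdf (- x))%:E = 1.
  have mEN := measurableT_comp mE (@oppr_measurable R setT).
  have hN0 (x : R) : 0 <= (std_cdf (- x)%R)%:E by rewrite lee_fin std_cdf_ge0.
  transitivity (\int[gamma]_x ((std_cdf x)%:E + (std_cdf (- x))%:E)).
    apply/esym/ge0_integralD; [exact: measurableT|by move=> x _;
      exact: h0|exact: mE|by move=> x _; exact: hN0|exact: mEN].
  under eq_integral do rewrite -EFinD std_cdfN addrC subrK.
  rewrite (integral_cst _ measurableT 1) [X in 1 * X](probability_setT gamma).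
  exact: mule1.
by rewrite hN; exact: ereal_half.
Qed.

(** By Tonelli, the integral is that of [(1 + s^2 + c^2 t^2)^(-3/2) / (2 pi)]
    over the unit square. The factor [c] comes from the derivative of
    the arcsine; finiteness is stated apart because the equation does not give
    it when [c = 0]. *)
Lemma integral_std_sqr_mean_pdfM (c : R) :
  (c%:E * \int[gamma]_x (x ^+ 2 * mean_pdf x * mean_pdf (c * x))%:E =
  (asin (c / (Num.sqrt 2 * Num.sqrt (1 + c ^+ 2))) / (2 * pi))%:E) /\
  \int[gamma]_x (x ^+ 2 * mean_pdf x * mean_pdf (c * x))%:E < +oo.
Proof.
pose k (t : R) := ((1 + (t * c) ^+ 2) * Num.sqrt (1 + (t * c) ^+ 2 + 1))^-1%R.
have a0 t : (0 < 1 + (t * c) ^+ 2)%R by rewrite ltr_pwDl// sqr_ge0.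
have k0 t : (0 <= k t)%R by rewrite invr_ge0 mulr_ge0 ?sqrtr_ge0// ltW.
have ck : continuous k.
  have -> : k = (fun t : R =>
      ((1 + c ^+ 2 * t ^+ 2) * Num.sqrt (2 + c ^+ 2 * t ^+ 2))^-1)%R.
    apply/funext => t; rewrite /k exprMn [(t ^+ 2 * _)%R]mulrC.
    by congr (_ * Num.sqrt _)^-1%R; ring.
  move=> t; apply: cvgV.
    rewrite gt_eqF// mulr_gt0 ?sqrtr_gt0// ltr_pwDl// mulr_ge0 ?sqr_ge0//.
  apply: cvgM; last by apply: continuous_sqrt_quad; rewrite ?sqr_ge0.
  apply: cvgD; first exact: cvg_cst.
  by apply: cvgMr; exact: exprn_continuous.
have ik : mu.-integrable `[0%R, 1%R] (EFin \o k).
  by apply: continuous_compact_integrable;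
    [exact: segment_compact|exact: continuous_subspaceT].
have mx : measurable_fun [set: R] (fun x : R => x ^+ 2 * phi x * mean_pdf x)%R.
  by apply: measurable_funM => //; apply: measurable_funM => //;
    exact: measurable_funX.
have -> : \int[gamma]_x (x ^+ 2 * mean_pdf x * mean_pdf (c * x))%:E =
   (2 * pi)^-1%:E * \int[mu]_(t in `[0%R, 1%R]) (k t)%:E.
  rewrite ge0_integral_std; last 2 first.
  - apply/measurable_EFinP/measurable_funM.
      by apply: measurable_funM => //; exact: measurable_funX.
    by apply: (measurableT_comp mmean); exact: measurable_funM.
  - by move=> x; rewrite lee_fin mulr_ge0 ?std_pdf_ge0 ?mean_pdf_ge0// mulr_ge0
      ?sqr_ge0 ?mean_pdf_ge0.
  transitivity (\int[mu]_x ((x ^+ 2 * phi x * mean_pdf x) * mean_pdf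
    (c * x))%:E).
    by apply: eq_integral => x _; rewrite -EFinM; congr EFin; ring.
  rewrite ge0_integral_mean_pdf//; last first.
    by move=> x; rewrite mulr_ge0 ?std_pdf_ge0 ?mean_pdf_ge0// mulr_ge0
      ?sqr_ge0 ?mean_pdf_ge0 ?std_pdf_ge0.
  rewrite -ge0_integralZl//; last 3 first.
  - by apply/measurable_EFinP/measurable_funTS;
      exact: continuous_measurable_fun.
  - by move=> t _; rewrite lee_fin.
  - by rewrite lee_fin invr_ge0 mulr_ge0// pi_ge0.
  apply: eq_integral => t _.
  transitivity (\int[mu]_x ((x ^+ 2 * phi x * phi (t * (c * x))) * mean_pdf
    (1 * x))%:E).
    by apply: eq_integral => x _; rewrite mul1r; congr EFin; ring.
  rewrite ge0_integral_mean_pdf; last 2 first.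
  - apply: measurable_funM.
      by apply: measurable_funM => //; exact: measurable_funX.
    by apply: (measurableT_comp mpdf); apply: measurable_funM => //;
      exact: measurable_funM.
  - by move=> x; rewrite mulr_ge0 ?std_pdf_ge0 ?mean_pdf_ge0// mulr_ge0
      ?sqr_ge0 ?std_pdf_ge0.
  rewrite /k -integral_cube_sqrt// -ge0_integralZl//; last 2 first.
  - by apply/measurable_EFinP; exact: measurable_inv_cube_sqrt.
  - by rewrite lee_fin invr_ge0 mulr_ge0// pi_ge0.
  apply: eq_integral => s _; set r := Num.sqrt (1 + (t * c) ^+ 2 + s ^+ 2).
  have r2 : (r ^+ 2 = 1 + (t * c) ^+ 2 + s ^+ 2)%R.
    by rewrite sqr_sqrtr// addr_ge0 ?sqr_ge0// ltW.
  have r0 : (0 < r)%R by rewrite sqrtr_gt0 ltr_pwDl// sqr_ge0.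
  rewrite -integral_sqr_std_pdf_scale// -ge0_integralZl//; last 3 first.
  - apply/measurable_EFinP/measurable_funM; first exact: measurable_funX.
    by apply: (measurableT_comp mpdf); exact: measurable_funM.
  - by move=> x _; rewrite lee_fin mulr_ge0 ?sqr_ge0 ?std_pdf_ge0.
  - by rewrite lee_fin invr_ge0 mulr_ge0// pi_ge0.
  apply: eq_integral => x _; rewrite -EFinM; congr EFin.
  rewrite -normal_peak1_sqr mul1r;
    pose u := Num.sqrt (x ^+ 2 + (t * (c * x)) ^+ 2).
  have u2 : (u ^+ 2 = x ^+ 2 + (t *
    (c * x)) ^+ 2)%R by rewrite sqr_sqrtr// addr_ge0 ?sqr_ge0.
  rewrite -[(x ^+ 2 * _ * _)%R]mulrA (std_pdf_mul u2) -!mulrA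
    (@std_pdf_mul _ _ _ (r * x)).
    by ring.
  by rewrite u2 exprMn r2; ring.
split.
  rewrite muleCA -integralZl//.
  under eq_integral do rewrite -EFinM.
  by rewrite integral_asin_kernel -EFinM mulrC.
have ifin : \int[mu]_(t in `[0%R, 1%R])
  (k t)%:E \is a fin_num by exact: integrable_fin_num.
by rewrite -(fineK ifin) -EFinM ltry.
Qed.

(** Averaging over [x] and [- x] removes the odd terms of the product of
    [1 / 2 + x * mean_pdf x] and [1 / 2 + c * x * mean_pdf (c * x)]. *)
Lemma integral_std_cdfM (c : R) :
  \int[gamma]_x (std_cdf x * std_cdf (c * x))%:E =
  (1 / 4 + asin (c / (Num.sqrt 2 * Num.sqrt (1 + c ^+ 2))) / (2 * pi))%:E.
Proof.
pose h x := (std_cdf x * std_cdf (c * x))%:E.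
pose g x := (x ^+ 2 * mean_pdf x * mean_pdf (c * x))%:E.
have mh : measurable_fun [set: R] h.
  apply/measurable_EFinP/measurable_funM => //.
  by apply: (measurableT_comp mcdf); exact: measurable_funM.
have mg : measurable_fun [set: R] g.
  apply/measurable_EFinP/measurable_funM.
    by apply: measurable_funM => //; exact: measurable_funX.
  by apply: (measurableT_comp mmean); exact: measurable_funM.
have g0 x : 0 <= g x by rewrite lee_fin mulr_ge0 ?std_pdf_ge0 ?mean_pdf_ge0//
  mulr_ge0 ?sqr_ge0 ?mean_pdf_ge0.
have h0 x : 0 <= h x by rewrite lee_fin mulr_ge0 ?std_cdf_ge0.
have [Ig goo] := integral_std_sqr_mean_pdfM c.
have ig : gamma.-integrable [set: R] g.
  by apply/integrableP; split=> //; under eq_integral do rewrite gee0_abs//.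
have hN := ge0_integral_std_opp mh h0.
have : \int[gamma]_x h x + \int[gamma]_x h (- x)%R =
    \int[gamma]_x (cst (1 / 2)%:E x + (2 * c)%:E * g x).
  have mhN := measurableT_comp mh (@oppr_measurable R setT).
  transitivity (\int[gamma]_x (h x + h (- x)%R)).
    apply/esym/ge0_integralD; [exact: measurableT|by move=> x _;
      exact: h0|exact: mh
      |by move=> x _; exact: h0|exact: mhN].
  apply: eq_integral => x _;
    rewrite /h /g /cst -EFinD -EFinM -EFinD mulrN !std_cdfN.
  by congr EFin; rewrite /std_cdf; field.
have -> : \int[gamma]_x (cst (1 / 2)%:E x + (2 * c)%:E * g x) =
    \int[gamma]_x (cst (1 / 2)%:E x) + \int[gamma]_x ((2 * c)%:E * g x).
  apply: integralD; [exact: measurableT| |exact: integrableZl].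
  exact: (finite_measure_integrable_cst gamma).
rewrite (integral_cst _ measurableT) [X in _ * X + _](probability_setT gamma)
  mule1.
rewrite (integralZl measurableT ig) [(2 * c)%:E]EFinM -muleA Ig hN.
rewrite -EFinM -EFinD => /ereal_half ->.
by congr EFin; move: (asin _ / _)%R => w; field.
Qed.

(** For independent standard normal [z] and [y], both sides are the probability
    that [z - b * y <= a], since [z - b * y] is normal with variance
    [1 + b ^+ 2]: shift [z] by [b * y], complete the square in [y] and integrate
    [y] out. *)
Lemma integral_std_cdf_affine (a b : R) :
  \int[gamma]_y (std_cdf (a + b * y))%:E = (std_cdf (a / Num.sqrt
    (1 + b ^+ 2)))%:E.
Proof.
pose A : set R := `]-oo, a]%classic.
have mA : measurable A by exact: measurable_itv.
pose tau := Num.sqrt (1 + b ^+ 2).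
have tau0 : (0 < tau)%R by rewrite sqrtr_gt0 ltr_pwDl// sqr_ge0.
have tau2 : (tau ^+ 2 = 1 + b ^+ 2)%R by rewrite sqr_sqrtr// addr_ge0// sqr_ge0.
pose f (p : R * R) := (\1_A p.2 * (phi (p.2 + b * p.1) * phi p.1))%:E.
have mf : measurable_fun [set: R * R] f.
  apply/measurable_EFinP/measurable_funM.
    by apply: measurableT_comp; [exact: measurable_indic|exact: measurable_snd].
  apply: measurable_funM; last by apply: (measurableT_comp mpdf);
    exact: measurable_fst.
  apply: (measurableT_comp mpdf); apply: measurable_funD;
    first exact: measurable_snd.
  by apply: measurable_funM => //; exact: measurable_fst.
have f0 p : 0 <= f p.
  by rewrite lee_fin !mulr_ge0 ?std_pdf_ge0// indicE ler0n.
have ipdf : \int[mu]_y (phi y)%:E = 1 by exact: integral_normal_pdf.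
transitivity (\int[mu]_y \int[mu]_z f (y, z)).
  rewrite ge0_integral_std; last 2 first.
  - apply/measurable_EFinP/(measurableT_comp mcdf).
    by apply: measurable_funD => //; exact: measurable_funM.
  - by move=> y; rewrite lee_fin std_cdf_ge0.
  apply: eq_integral => y _; rewrite -normal_prob_Nyc normal_prob_indic//.
  rewrite -(@ge0_integral_shift _ _ (b * y)); last 2 first.
  - by apply/measurable_EFinP/measurable_funM => //; exact: measurable_indic.
  - by move=> z; rewrite lee_fin mulr_ge0 ?std_pdf_ge0// indicE ler0n.
  rewrite -ge0_integralZr//; last 3 first.
  - apply/measurable_EFinP/measurable_funM.
      apply: measurableT_comp; first exact: measurable_indic.
      exact: measurable_funD.
    by apply: (measurableT_comp mpdf); exact: measurable_funD.
  - by move=> z _; rewrite lee_fin mulr_ge0 ?std_pdf_ge0// indicE ler0n.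
  - by rewrite lee_fin std_pdf_ge0.
  apply: eq_integral => z _; rewrite -EFinM /f/= mulrA; congr (_ * _ * _)%:E.
  by rewrite !indicE !mem_setE !in_itv/= lerD2r.
rewrite fubini_tonelli//.
pose h u := (\1_A (tau * u) * phi u)%:E.
have mh : measurable_fun [set: R] h.
  apply/measurable_EFinP/measurable_funM => //.
  by apply: measurableT_comp; [exact: measurable_indic|exact: measurable_funM].
have h0 u : 0 <= h u by rewrite lee_fin mulr_ge0 ?std_pdf_ge0// indicE ler0n.
transitivity (\int[mu]_z (tau^-1%:E * h (tau^-1 * z)%R)).
  apply: eq_integral => z _.
  have tz : (tau * (tau^-1 * z) = z)%R by rewrite mulrA mulfV ?mul1r// gt_eqF.
  transitivity (\int[mu]_y (h (tau^-1 * z)%R * (phi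
    (tau * y + b * z / tau))%:E)).
    apply: eq_integral => y _;
      rewrite /f /h -EFinM/= tz -[(\1_A z * _ * _)%R]mulrA.
    congr (_ * _)%:E; rewrite !std_pdfE mulrACA [RHS]mulrACA -!expRD.
    congr (_ * expR _)%R.
    apply/eqP; rewrite -subr_eq0; apply/eqP.
    (* the difference of the exponents is a multiple of [tau^2 - (1 + b^2)] *)
    transitivity (- ((tau ^+ 2 - (1 + b ^+ 2)) *
      ((z / tau) ^+ 2 - y ^+ 2)) / 2)%R.
      by field; rewrite gt_eqF.
    by rewrite tau2 subrr mul0r oppr0 mul0r.
  rewrite ge0_integralZl//; last 2 first.
  - apply/measurable_EFinP/(measurableT_comp mpdf).
    by apply: measurable_funD => //; exact: measurable_funM.
  - by move=> y _; rewrite lee_fin std_pdf_ge0.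
  rewrite muleC; congr (_ * _).
  have m1 : measurable_fun [set: R] (fun y => (phi (y + b * z / tau))%:E).
    by apply/measurable_EFinP/(measurableT_comp mpdf); exact: measurable_funD.
  rewrite (@ge0_integral_scale R (fun y => (phi
    (y + b * z / tau))%:E) tau) ?gt_eqF//; last first.
    by move=> y; rewrite lee_fin std_pdf_ge0.
  rewrite (@ge0_integral_shift R (fun y =>
    (phi y)%:E)) ?ipdf ?mule1 ?gtr0_norm//.
  - exact/measurable_EFinP.
  - by move=> y; rewrite lee_fin std_pdf_ge0.
rewrite ge0_integralZl//; last 2 first.
- by apply: (measurableT_comp mh); exact: measurable_funM.
- by rewrite lee_fin invr_ge0 ltW.
rewrite ge0_integral_scale ?invr_eq0 ?gt_eqF// normfV invrK gtr0_norm//.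
rewrite muleA -EFinM mulVf ?gt_eqF// mul1e -normal_prob_Nyc normal_prob_indic//.
apply: eq_integral => u _; congr (_ * _)%:E.
by rewrite !indicE !mem_setE !in_itv/= ler_pdivlMr// mulrC.
Qed.
End gaussian_cdf_integrals.

(** * Lebesgue measure on tuples, one coordinate at a time *)

Section insertion.
Context {R : realType}.
Local Notation B := (measurableTypeR R).
Local Notation mu := (@lebesgue_measure R).

Definition tuple_insert n (l : 'I_n.+1) (x : B)
  (t : n.-tuple B) : n.+1.-tuple B :=
  [tuple (if unlift l k is Some j then tnth t j else x) | k < n.+1].

Lemma tnth_insert n (l : 'I_n.+1) x (t : n.-tuple B) :
  tnth (tuple_insert l x t) l = x.
Proof. by rewrite tnth_mktuple unlift_none. Qed.

Lemma tnth_insert_lift n (l : 'I_n.+1) x (t : n.-tuple B) j :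
  tnth (tuple_insert l x t) (lift l j) = tnth t j.
Proof. by rewrite tnth_mktuple liftK. Qed.

Lemma tuple_insert0 n x (t : n.-tuple B) :
  tuple_insert ord0 x t = tuple_cons (x, t).
Proof.
apply: eq_from_tnth => k; have [j ->|->] := unliftP ord0 k.
  by rewrite tnth_insert_lift /tuple_cons tnthS.
by rewrite tnth_insert tnth0.
Qed.

Lemma tuple_insertS n (j : 'I_n.+1) x x0 (t : n.-tuple B) :
  tuple_insert (lift ord0 j) x (tuple_cons (x0, t)) =
  tuple_cons (x0, tuple_insert j x t).
Proof.
apply: eq_from_tnth => k; have [i ->|->] := unliftP ord0 k; last first.
  have -> : ord0 = lift (lift ord0 j) ord0 :> 'I_n.+2 by apply/val_inj.
  rewrite tnth_insert_lift tnth0.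
  have -> : lift (lift ord0 j) ord0 = ord0 :> 'I_n.+2 by apply/val_inj.
  by rewrite tnth0.
rewrite [RHS]tnthS/=; have [i' ->|->] := unliftP j i; last first.
  by rewrite !tnth_insert.
rewrite tnth_insert_lift.
have -> : lift ord0 (lift j i') = lift (lift ord0 j) (lift ord0 i').
  by apply/val_inj; rewrite /= /bump/= !add1n ltnS; case: leqP; rewrite ?addnS.
by rewrite tnth_insert_lift tnthS.
Qed.

Lemma measurable_tuple_insert n
  (l : 'I_n.+1) : measurable_fun [set: B * n.-tuple B]
  (fun p => tuple_insert l p.1 p.2).
Proof.
apply/measurable_fun_tnthP => k; have [j ->|->] := unliftP l k.
  rewrite (_ : _ \o _ = (fun t : n.-tuple B => tnth t j) \o snd).
    by apply: measurableT_comp => //; exact: measurable_tnth.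
  by apply/funext => p /=; rewrite tnth_insert_lift.
rewrite (_ : _ \o _ = fst)//.
by apply/funext => p /=; rewrite tnth_insert.
Qed.

Local Open Scope ereal_scope.

(** Tonelli's theorem moves the coordinate [l] past the previous ones, by
    induction on the dimension. *)
Lemma ge0_integral_insert n (l : 'I_n.+1) (g : n.+1.-tuple B -> \bar R) :
  measurable_fun [set: n.+1.-tuple B] g -> (forall t, 0 <= g t) ->
  \int[lebesgue_measure_tuple R n.+1]_t g t =
  \int[lebesgue_measure_tuple R n]_t \int[mu]_x g (tuple_insert l x t).
Proof.
have consE m (h : m.+1.-tuple B -> \bar R) :
    measurable_fun [set: m.+1.-tuple B] h -> (forall t, 0 <= h t) ->
    \int[lebesgue_measure_tuple R m.+1]_t h t =
    \int[mu]_x \int[lebesgue_measure_tuple R m]_t h (tuple_cons (x, t)).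
  move=> mh h0; rewrite [LHS]ge0_integral_pushforward//;
    last exact: measurable_tuple_cons.
  rewrite preimage_setT (fubini_tonelli1 (h \o @tuple_cons R m))//.
    by apply: measurableT_comp => //; exact: measurable_tuple_cons.
  by move=> p; exact: h0.
elim: n => [|n IH] in l g *.
  move=> mg g0; rewrite consE//; have -> : l = ord0 by apply/val_inj;
    case: l => -[].
  rewrite (fubini_tonelli (fun p => g (tuple_cons p)))//=.
    by under eq_integral do under eq_integral do rewrite -tuple_insert0.
  by apply: measurableT_comp => //; exact: measurable_tuple_cons.
move=> mg g0; rewrite consE//; have [j ->|->] := unliftP ord0 l; last first.
  rewrite (fubini_tonelli (fun p => g (tuple_cons p)))//=.
    by under eq_integral do under eq_integral do rewrite -tuple_insert0.
  by apply: measurableT_comp => //; exact: measurable_tuple_cons.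
rewrite consE; last 2 first.
- have := @measurable_fun_fubini_tonelli_G _ _ _ _ _ mu
    (fun p : B * n.+1.-tuple B => g (tuple_insert (lift ord0 j) p.1 p.2)).
  apply => //; apply: measurableT_comp => //; exact: measurable_tuple_insert.
- by move=> t; exact: integral_ge0.
apply: eq_integral => x0 _; rewrite (IH j)//.
- by under eq_integral do under eq_integral do rewrite -tuple_insertS.
- apply: (measurableT_comp mg); apply: measurableT_comp;
    first exact: measurable_tuple_cons.
  exact: measurable_fun_pair.
Qed.
End insertion.

(** * Splitting a Gaussian density along one coordinate *)

Section minors.
Context {R : realType}.

(** The covariance matrix of the vector without its coordinate [l]. *)
Definition minor_mx n (l : 'I_n.+1) (C : 'M[R]_n.+1) : 'M[R]_n := row' l
  (col' l C).

Lemma minor_mxE n (l : 'I_n.+1) (C : 'M[R]_n.+1) i j :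
  minor_mx l C i j = C (lift l i) (lift l j).
Proof. by rewrite !mxE. Qed.

Section fixed_minor.
Variables (n : nat) (l : 'I_n.+1) (C : 'M[R]_n.+1).
Hypothesis pdC : posdefmx C.
Local Notation D := (minor_mx l C).
Local Notation Q := (invmx C).

Lemma sum_lift (F : 'I_n.+1 -> R) : \sum_k F k = F l + \sum_j F (lift l j).
Proof. by rewrite (bigD1_ord l). Qed.

Lemma posdef_minor : posdefmx D.
Proof.
split; first by apply/matrixP => i j; rewrite mxE !minor_mxE -[in LHS]pdC.1 mxE.
move=> v v0; pose x : 'cV[R]_n.+1 := \col_k
  (if unlift l k is Some j then v j ord0 else 0).
have xl : x l ord0 = 0 by rewrite mxE unlift_none.
have xj j : x (lift l j) ord0 = v j ord0 by rewrite mxE liftK.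
have x0 : x != 0.
  apply: contra_neq v0 => x0; apply/matrixP => j k.
  by rewrite (ord1 k) -xj x0 !mxE.
have := pdC.2 _ x0; rewrite -!/(bform _ _ _) !bformE sum_lift big1 ?add0r;
  last first.
  by move=> k _; rewrite xl !mul0r.
congr (0 < _); apply: eq_bigr => i _; rewrite sum_lift xl mulr0 add0r.
by apply: eq_bigr => j _; rewrite minor_mxE !xj.
Qed.

Lemma inv_diag_gt0 : 0 < Q l l.
Proof. exact: posdef_diag_gt0 (posdef_inv pdC). Qed.

(** Cramer's formula for the diagonal entry of [C^-1]. *)
Lemma det_minor : \det D = \det C * Q l l.
Proof.
have uC := posdef_unitmx pdC; rewrite /invmx uC mxE mulrA divrr ?mul1r;
  last by rewrite -unitmxE.
rewrite mxE /cofactor addnn -signr_odd odd_double expr0 mul1r.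
by rewrite /minor_mx; congr (\det _); apply/matrixP => i j; rewrite !mxE.
Qed.

(** Subtracting from [x] the multiple of the basis vector at [l] that cancels
    coordinate [l] of [C^-1 x] splits the quadratic form orthogonally. *)
Lemma bform_inv_minor (x : 'cV[R]_n.+1) :
  bform Q x x = bform (invmx D) (row' l x) (row' l x) +
    (Q *m x) l ord0 ^+ 2 / Q l l.
Proof.
have q0 := inv_diag_gt0; set q := Q l l in q0 *; set w := (Q *m x) l ord0.
have sQ : Q^T = Q by exact: trmx_inv_sym pdC.1.
pose e : 'cV[R]_n.+1 := delta_mx l ord0.
(* [u = Q z] vanishes at [l], so its other coordinates are [D^-1] times those
   of [x] *)
pose z := x - (w / q) *: e; pose u := Q *m z.
have zj j : z (lift l j) ord0 = x (lift l j) ord0.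
  by rewrite !mxE eq_sym (negbTE (neq_lift _ _)) mulr0 subr0.
have Qe k : (Q *m e) k ord0 = Q k l by rewrite -colE mxE.
have ul : u l ord0 = 0.
  by rewrite /u mulmxBr -scalemxAr mxE -/w mxE mxE Qe -/q divfK ?subrr// gt_eqF.
have Cu : C *m u = z by rewrite mulKVmx// posdef_unitmx.
have u'E : row' l u = invmx D *m row' l x.
  rewrite -[LHS](mulKmx (posdef_unitmx posdef_minor)); congr (_ *m _).
  apply/matrixP => i j; rewrite (ord1 j) [RHS]mxE -zj -Cu !mxE [RHS]sum_lift.
  rewrite ul mulr0 add0r; apply: eq_bigr => k _; rewrite minor_mxE mxE//.
have zz : bform Q z z = bform (invmx D) (row' l x) (row' l x).
  rewrite /bform -!mulmxA -/u -u'E [LHS]mxE [RHS]mxE sum_lift ul mulr0 add0r.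
  apply: eq_bigr => j _; congr (_ * _); last by rewrite [RHS]mxE.
  by rewrite [LHS]mxE zj [RHS]mxE [RHS]mxE.
have ez : bform Q e z = 0.
  by rewrite /bform -mulmxA trmx_delta -rowE -[RHS]ul mxE.
have key (y : 'cV[R]_n.+1) c : bform Q e y = 0 ->
    bform Q (y + c *: e) (y + c *: e) = bform Q y y + c ^+ 2 * q.
  move=> ey; rewrite bformDl !bformDr !bformZl !bformZr (bformC y e sQ) ey.
  by rewrite bform_delta -/q !mulr0 add0r addr0; ring.
have := key z (w / q) ez; rewrite zz /z subrK => ->.
by congr (_ + _); field; rewrite gt_eqF.
Qed.
End fixed_minor.

Lemma posdef_det_gt0 n (C : 'M[R]_n) : posdefmx C -> 0 < \det C.
Proof.
elim: n => [|n IH] in C *; first by rewrite det_mx00.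
move=> pdC; have := IH _ (posdef_minor ord0 pdC).
by rewrite det_minor// pmulr_lgt0// inv_diag_gt0.
Qed.

(** The conditional law of coordinate [l] given the others is normal with
    variance [1 / (C^-1)_ll], and [(C^-1 x)_l / (C^-1)_ll] is the deviation of
    [x_l] from its conditional mean. *)
Lemma gaussian_pdf_minor n (l : 'I_n.+1) (C : 'M[R]_n.+1) (x : 'cV[R]_n.+1) :
  posdefmx C ->
  gaussian_pdf C x = gaussian_pdf (minor_mx l C) (row' l x) *
    normal_pdf 0 (Num.sqrt (invmx C l l))^-1
      ((invmx C *m x) l ord0 / invmx C l l).
Proof.
move=> pdC; have q0 := inv_diag_gt0 l pdC.
have s0 : 0 < Num.sqrt (invmx C l l) by rewrite sqrtr_gt0.
rewrite normal_pdfE ?gt_eqF ?invr_gt0// /gaussian_pdf /normal_peak /normal_fun.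
rewrite -!/(bform _ _ _) (bform_inv_minor l pdC) subr0 exprVn sqr_sqrtr ?ltW//.
rewrite (det_minor l pdC); set q := invmx C l l in q0 *.
set w := (_ *m _) l ord0; rewrite [RHS]mulrACA -expRD; congr (_ * expR _);
  last first.
  by field; rewrite gt_eqF.
have d0 : 0 <= (2 * pi) ^+ n * (\det C * q).
  by apply: mulr_ge0; [apply: exprn_ge0;
    rewrite mulr_ge0 ?pi_ge0|rewrite mulr_ge0 ?ltW// posdef_det_gt0].
rewrite -invfM -(sqrtrM _ d0); congr ((Num.sqrt _)^-1); rewrite exprS.
by field; rewrite gt_eqF.
Qed.

End minors.

(** * Gaussian vectors: independence and marginals *)

Section gaussian_vector.
Context {R : realType}.
Local Notation B := (measurableTypeR R).
Local Notation mu := (@lebesgue_measure R).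
Local Notation gamma := (@normal_prob R 0 1).

Definition tuple_col n (t : n.-tuple B) : 'cV[R]_n := \col_k tnth t k.

Lemma measurable_linear_form n (M : 'M[R]_n) (l : 'I_n) :
  measurable_fun [set: n.-tuple B] (fun t => (M *m tuple_col t) l ord0).
Proof.
rewrite (_ : (fun _ => _) = fun t : n.-tuple B => \sum_k M l k * tnth t k).
  apply: measurable_sum => k; apply: measurable_funM => //.
  exact: measurable_tnth.
by apply/funext => t; rewrite mxE; apply: eq_bigr => k _; rewrite mxE.
Qed.

Lemma measurable_gaussian_pdf n (C : 'M[R]_n) :
  measurable_fun [set: n.-tuple B] (fun t => gaussian_pdf C (tuple_col t)).
Proof.
apply: measurable_funM => //; apply: measurableT_comp => //.
rewrite (_ : (fun _ => _) = fun t : n.-tuple B =>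
    - (\sum_k tnth t k * (invmx C *m tuple_col t) k ord0) / 2).
  apply: measurable_funM => //; apply: measurableT_comp => //.
  apply: measurable_sum => k; apply: measurable_funM;
    first exact: measurable_tnth.
  exact: measurable_linear_form.
apply/funext => t; congr (- _ / _); rewrite -mulmxA mxE.
by apply: eq_bigr => k _; rewrite !mxE.
Qed.

Lemma gaussian_pdf_ge0 n (C : 'M[R]_n) x : 0 <= gaussian_pdf C x.
Proof. by rewrite mulr_ge0 ?expR_ge0// invr_ge0. Qed.

Lemma row'_tuple_col_insert n (l : 'I_n.+1) x (t : n.-tuple B) :
  row' l (tuple_col (tuple_insert l x t)) = tuple_col t.
Proof. by apply/matrixP => i j; rewrite !mxE tnth_insert_lift. Qed.

Local Open Scope ereal_scope.

(** Integrating [x_l] first, the deviation from the conditional mean differs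
    from [x_l] by a quantity that depends only on the other coordinates, so a
    translation makes it independent of them. *)
Lemma integral_regression n (l : 'I_n.+1) (C : 'M[R]_n.+1)
    (h : n.-tuple B * R -> \bar R) : posdefmx C ->
  measurable_fun [set: n.-tuple B * R] h -> (forall p, 0 <= h p) ->
  \int[lebesgue_measure_tuple R n.+1]_t
    (h ([tuple tnth t (lift l j) | j < n], (invmx C *m tuple_col t) l ord0) *
     (gaussian_pdf C (tuple_col t))%:E) =
  \int[lebesgue_measure_tuple R n]_t
    ((\int[gamma]_z h (t, Num.sqrt (invmx C l l) * z)%R) *
     (gaussian_pdf (minor_mx l C) (tuple_col t))%:E).
Proof.
move=> pdC mh h0; have q0 := inv_diag_gt0 l pdC.
set q := invmx C l l in q0 *; set W := invmx C; set D := minor_mx l C.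
have s0 : (0 < Num.sqrt q)%R by rewrite sqrtr_gt0.
have si0 : (0 < (Num.sqrt q)^-1)%R by rewrite invr_gt0.
rewrite (ge0_integral_insert l); last 2 first.
- apply: emeasurable_funM; last by apply/measurable_EFinP;
    exact: measurable_gaussian_pdf.
  apply: (measurableT_comp mh); apply: measurable_fun_pair.
    apply/measurable_fun_tnthP => j.
    rewrite (_ : _ \o _ = (fun t : n.+1.-tuple B => tnth t (lift l j))).
      exact: measurable_tnth.
    by apply/funext => t /=; rewrite tnth_mktuple.
  exact: measurable_linear_form.
- by move=> t; rewrite mule_ge0// lee_fin gaussian_pdf_ge0.
apply: eq_integral => t _.
pose r := ((\sum_j W l (lift l j) * tnth t j) / q)%R.
have WE x : ((W *m tuple_col (tuple_insert l x t)) l ord0 = q * (x + r))%R.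
  rewrite mxE (sum_lift l) mxE tnth_insert mulrDr /r [X in (_ + X)%R =
    _](_ : _ = \sum_j W l (lift l j) * tnth t j)%R.
    by rewrite [(_ / q)%R]mulrC mulVKf// gt_eqF.
  by apply: eq_bigr => j _; rewrite mxE tnth_insert_lift.
have mht : measurable_fun [set: R] (fun x => h (t, (q * x)%R)).
  by apply: (measurableT_comp mh); apply: measurable_fun_pair => //;
    exact: measurable_funM.
pose g x := h (t, (q * x)%R) * (normal_pdf 0 (Num.sqrt q)^-1 x)%:E.
have mg : measurable_fun [set: R] g.
  by apply: emeasurable_funM => //; apply/measurable_EFinP;
    exact: measurable_normal_pdf.
have g0 x : 0 <= g x by rewrite mule_ge0// lee_fin normal_pdf_ge0.
transitivity (\int[mu]_x (g (x + r)%R * (gaussian_pdf D (tuple_col t))%:E)).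
  apply: eq_integral => x _.
  rewrite (gaussian_pdf_minor l _ pdC) row'_tuple_col_insert WE -/q /g -muleA
    -EFinM.
  rewrite [(q * _ / q)%R]mulrAC mulfV ?mul1r ?gt_eqF// [(_ * gaussian_pdf _
    _)%R]mulrC.
  by congr (h (_, _) * _); apply: eq_from_tnth => j;
    rewrite tnth_mktuple tnth_insert_lift.
rewrite ge0_integralZr//; last 2 first.
- by apply: (measurableT_comp mg); exact: measurable_funD.
- by rewrite lee_fin gaussian_pdf_ge0.
congr (_ * _); rewrite (ge0_integral_shift _ mg g0)
  (ge0_integral_normal_scale si0 mht)//.
apply: eq_integral => z _; congr (h (_, _)).
by rewrite mulrA -{1}(sqr_sqrtr (ltW q0)) expr2 mulfK// gt_eqF.
Qed.

Section random_vector.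
Context {d : measure_display} {T : measurableType d} (P : probability T R).

Definition rvec n (X : 'I_n -> {RV P >-> R}) (w : T) : n.-tuple B :=
  [tuple X k w | k < n].

Lemma measurable_rvec n (X : 'I_n -> {RV P >-> R}) : measurable_fun [set: T]
  (rvec X).
Proof.
apply/measurable_fun_tnthP => k; rewrite (_ : _ \o _ = fun w => X k w);
  first exact: (measurable_funPT (X k)).
by apply/funext => w /=; rewrite tnth_mktuple.
Qed.

Lemma ge0_integral_rvec n (X : 'I_n -> {RV P >-> R}) (C : 'M[R]_n)
    (g : n.-tuple B -> \bar R) : has_density X (gaussian_pdf C) ->
  measurable_fun [set: n.-tuple B] g -> (forall t, 0 <= g t) ->
  \int[P]_w g (rvec X w) =
  \int[lebesgue_measure_tuple R n]_t (g t * (gaussian_pdf C (tuple_col t))%:E).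
Proof.
move=> hX mg g0.
pose mX := isMeasurableFun.Build _ _ _ _ _ (measurable_rvec X).
pose XV : {mfun T >-> n.-tuple B} := HB.pack (rvec X) mX.
rewrite -(ge0_integral_distribution XV mg g0).
apply: ge0_integral_density => //; first exact: measurable_gaussian_pdf.
by move=> t; exact: gaussian_pdf_ge0.
Qed.

Let tuple_col_rvec n (X : 'I_n -> {RV P >-> R}) w : tuple_col (rvec X w) =
  \col_k X k w.
Proof. by apply/matrixP => i j; rewrite !mxE tnth_mktuple. Qed.

Let measurable_residual n (l : 'I_n.+1) (C : 'M[R]_n.+1) :
  measurable_fun [set: n.+1.-tuple B] (fun t : n.+1.-tuple B =>
    ([tuple tnth t (lift l j) | j < n] : n.-tuple B,
      (invmx C *m tuple_col t) l ord0)).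
Proof.
apply: measurable_fun_pair; last exact: measurable_linear_form.
apply/measurable_fun_tnthP => j.
rewrite (_ : _ \o _ = (fun t : n.+1.-tuple B => tnth t (lift l j))).
  exact: measurable_tnth.
by apply/funext => t /=; rewrite tnth_mktuple.
Qed.

Section regression.
Variables (n : nat) (X : 'I_n.+1 -> {RV P >-> R}) (C : 'M[R]_n.+1)
  (l : 'I_n.+1).
Hypotheses (pdC : posdefmx C) (hX : has_density X (gaussian_pdf C)).
Local Notation X' := (fun j => X (lift l j)).

Let ge0_integral_residual_density (h : n.-tuple B * R -> \bar R) :
  measurable_fun [set: n.-tuple B * R] h -> (forall p, 0 <= h p) ->
  \int[P]_w h (rvec X' w, (invmx C *m \col_k X k w) l ord0) =
  \int[lebesgue_measure_tuple R n]_t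
    ((\int[gamma]_z h (t, Num.sqrt (invmx C l l) * z)%R) *
     (gaussian_pdf (minor_mx l C) (tuple_col t))%:E).
Proof.
move=> mh h0; rewrite -integral_regression//.
rewrite -(ge0_integral_rvec (X := X) (g := fun t => h ([tuple tnth t
  (lift l j) | j < n],
  (invmx C *m tuple_col t) l ord0)) hX)//; last first.
  exact: (measurableT_comp mh (measurable_residual l C)).
apply: eq_integral => w _; rewrite tuple_col_rvec; congr (h (_, _)).
by apply: eq_from_tnth => j; rewrite !tnth_mktuple.
Qed.

(** The previous identity for a function of the other coordinates only. *)
Lemma has_density_minor :
  has_density X' (gaussian_pdf (minor_mx l C)).
Proof.
move=> A mA; pose h (p : n.-tuple B * R) : \bar R := (\1_A p.1)%:E.
have mh : measurable_fun [set: n.-tuple B * R] h.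
  by apply/measurable_EFinP; apply: measurableT_comp => //;
    exact: measurable_indic.
have h0 p : 0 <= h p by rewrite lee_fin indicE ler0n.
have := ge0_integral_residual_density mh h0.
have mA' : measurable [set w | A (rvec X' w)].
  by have := measurable_rvec X' measurableT mA; rewrite setTI.
rewrite [X in X = _ -> _](_ : _ = P [set w | A (rvec X' w)]); last first.
  by rewrite -[X in P X]setIT -integral_indic.
move=> ->; rewrite [RHS]integral_mkcond; apply: eq_integral => t _.
rewrite patchE /h/= integral_cst//= probability_setT mule1 indicE.
by case: ifP => _; rewrite ?mul1e ?mul0e.
Qed.

(** Independence, in integrated form, of [(C^-1 X)_l] and the other coordinates
    of [X], together with the normal law of variance [(C^-1)_ll] of the
    former. *)
Lemma ge0_integral_residual (h : n.-tuple B * R -> \bar R) :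
  measurable_fun [set: n.-tuple B * R] h -> (forall p, 0 <= h p) ->
  \int[P]_w h (rvec X' w, (invmx C *m \col_k X k w) l ord0) =
  \int[P]_w \int[gamma]_z h (rvec X' w, Num.sqrt (invmx C l l) * z)%R.
Proof.
move=> mh h0; rewrite ge0_integral_residual_density//.
rewrite -(ge0_integral_rvec (g := fun t => \int[gamma]_z h (t, Num.sqrt
  (invmx C l l) * z)%R)
  has_density_minor)//; last by move=> t; exact: integral_ge0.
apply: (@measurable_fun_fubini_tonelli_F _ _ _ _ _ gamma
  (fun p : n.-tuple B * R => h (p.1, Num.sqrt (invmx C l l) * p.2)%R)) => //.
apply: (measurableT_comp mh); apply: measurable_fun_pair => //.
exact: measurable_funM.
Qed.
End regression.
End random_vector.
End gaussian_vector.

(** * One- and two-dimensional marginals *)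

Lemma ord_avoid2 n (k l : 'I_n.+3) : exists i, (i != k) && (i != l).
Proof.
have : ~~ ([set: 'I_n.+3]%SET \subset [set k; l]%SET).
  by apply/negP => /subset_leq_card; rewrite cardsT card_ord cards2; case: eqP.
by move=> /subsetPn[i _]; rewrite !inE negb_or; exists i.
Qed.

Section marginals.
Context {R : realType}.
Local Notation B := (measurableTypeR R).
Local Notation gamma := (@normal_prob R 0 1).
Context {d : measure_display} {T : measurableType d} (P : probability T R).
Local Open Scope ereal_scope.

Lemma lift_neq n (l k : 'I_n.+1) : l != k -> exists j, k = lift l j.
Proof. by move=> lk; have [j ->|kl] := unliftP l k;
  [exists j|rewrite kl eqxx in lk]. Qed.

(** Coordinates other than [k] are removed one at a time. In dimension one,
    [X_k] is [C_kk] times the coordinate of [C^-1 X]. *)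
Lemma ge0_integral_marginal1 n (X : 'I_n -> {RV P >-> R}) (C : 'M[R]_n) k
    (h : R -> \bar R) : posdefmx C -> has_density X (gaussian_pdf C) ->
  measurable_fun [set: R] h -> (forall x, 0 <= h x) ->
  \int[P]_w h (X k w) = \int[gamma]_z h (Num.sqrt (C k k) * z)%R.
Proof.
elim: n => [|n IH] in X C k *; first by case: k.
move=> pdC hX mh h0; have := ord0; case: n => [|n] in X C k pdC hX IH *.
- move=> _; rewrite {k}(ord1 k); set k : 'I_1 := ord0;
    pose h' (p : 0.-tuple B * R) := h (C k k * p.2)%R.
  have q0 := inv_diag_gt0 k pdC.
  have Cq : (C k k * invmx C k k = 1)%R.
    have := mulmxV (posdef_unitmx pdC) => /matrixP/(_ k k).
    by rewrite !mxE big_ord1 eqxx.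
  have C0 := posdef_diag_gt0 k pdC.
  have mh' : measurable_fun [set: 0.-tuple B * R] h'.
    by apply: (measurableT_comp mh); apply: measurable_funM.
  have := ge0_integral_residual k pdC hX mh' (fun p => h0 _).
  rewrite /h'/= integral_cst//= probability_setT mule1 => e.
  transitivity (\int[P]_w h (C k k * (invmx C *m \col_k X k w) k ord0)%R).
    apply: eq_integral => w _; rewrite mxE big_ord1 mxE mulrA.
    by rewrite -/k Cq mul1r.
  rewrite e; apply: eq_integral => z _; congr h; rewrite mulrA; congr (_ * _)%R.
  have -> : invmx C k k = (C k k)^-1%R.
    by rewrite -[LHS]mul1r -(mulVf (lt0r_neq0 C0)) -mulrA Cq mulr1.
  have s0 : (0 < Num.sqrt (C k k))%R by rewrite sqrtr_gt0.
  by rewrite sqrtrV ?ltW// -{1}(sqr_sqrtr (ltW C0)) expr2 mulfK// gt_eqF.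
- move=> _; have [l /andP[lk _]] : exists l : 'I_n.+2, (l != k) && (l != k).
    have [->|k0] := eqVneq k ord0; first by exists ord_max.
    by exists ord0; rewrite eq_sym k0.
  have [j kE] := lift_neq lk.
  have := IH _ _ j (posdef_minor l pdC) (has_density_minor l pdC hX) mh h0.
  by rewrite minor_mxE -kE.
Qed.

(** Coordinates other than [k] and [l] are removed one at a time. In dimension
    two, [X_l = (C_kl / C_kk) X_k + (C^-1 X)_l / (C^-1)_ll], with independent
    terms. *)
Lemma ge0_integral_marginal2 n (X : 'I_n -> {RV P >-> R}) (C : 'M[R]_n) k l
    (h : R * R -> \bar R) : posdefmx C -> has_density X (gaussian_pdf C) ->
  k != l -> measurable_fun [set: R * R] h -> (forall x, 0 <= h x) ->
  \int[P]_w h (X k w, X l w) = \int[gamma]_x \int[gamma]_z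
    h (Num.sqrt (C k k) * x, C k l / Num.sqrt (C k k) * x +
       Num.sqrt (C l l - C k l ^+ 2 / C k k) * z)%R.
Proof.
elim: n => [|n IH] in X C k l *; first by case: k.
move=> pdC hX kl mh h0; case: n => [|[|n]] in X C k l pdC hX IH kl *.
- by move: kl; rewrite (ord1 k) (ord1 l).
- have [j kE] : exists j, k = lift l j by apply: lift_neq; rewrite eq_sym.
  have q0 := inv_diag_gt0 l pdC; have C0 := posdef_diag_gt0 k pdC.
  have j0 : j = ord0 by rewrite (ord1 j).
  have s2 (F : 'I_2 -> R) : (\sum_i F i = F l + F k)%R.
    by rewrite (sum_lift l) big_ord1 kE j0.
  have symC : C l k = C k l by rewrite -[in LHS]pdC.1 mxE.
  have e1 : (C l l * invmx C l l + C l k * invmx C k l = 1)%R.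
    by have := mulmxV (posdef_unitmx pdC) => /matrixP/(_ l l);
      rewrite !mxE s2 eqxx.
  have e2 : (C k l * invmx C l l + C k k * invmx C k l = 0)%R.
    have := mulmxV (posdef_unitmx pdC) => /matrixP/(_ k l).
    by rewrite !mxE s2 (negbTE kl).
  set q := invmx C l l in q0 e1 e2 *.
  have vq : (C l l - C k l ^+ 2 / C k k = q^-1)%R.
    have e3 : (invmx C k l = - (C k l * q) / C k k)%R.
      apply: (mulfI (lt0r_neq0 C0)); rewrite mulrCA mulfV ?gt_eqF// mulr1.
      by apply/eqP; rewrite -addr_eq0 addrC e2.
    move: e1; rewrite e3 symC => e1; apply: (mulIf (lt0r_neq0 q0)).
    by rewrite mulVf ?gt_eqF// -[RHS]e1; field; rewrite gt_eqF.
  pose h' (p : 1.-tuple B * R) :=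
    h (tnth p.1 j, C k l / C k k * tnth p.1 j + q^-1 * p.2)%R.
  have mt : measurable_fun [set: 1.-tuple B * R] (fun p : 1.-tuple B * R =>
    tnth p.1 j).
    by apply: (measurableT_comp (measurable_tnth j)).
  have mh' : measurable_fun [set: 1.-tuple B * R] h'.
    apply: (measurableT_comp mh); apply: measurable_fun_pair => //.
    by apply: measurable_funD; apply: measurable_funM.
  have := ge0_integral_residual l pdC hX mh' (fun p => h0 _).
  rewrite -/q => e.
  transitivity (\int[P]_w h' (rvec (fun j => X (lift l j)) w,
      (invmx C *m \col_k X k w) l ord0)).
    apply: eq_integral => w _; rewrite /h'/= tnth_mktuple -kE; congr (h (_, _)).
    have := mulKVmx (posdef_unitmx pdC) (\col_k X k w).
    move/matrixP => hw; have := hw k ord0; have := hw l ord0.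
    rewrite mxE s2 [RHS]mxE => <-; rewrite mxE s2 [RHS]mxE => <-.
    rewrite -vq symC; field; rewrite gt_eqF//.
  rewrite e; pose g x := \int[gamma]_z h (x, C k l / C k k * x + q^-1 *
    (Num.sqrt q * z))%R.
  have mg : measurable_fun [set: R] g.
    apply: (@measurable_fun_fubini_tonelli_F _ _ _ _ _ gamma (fun p : R * R =>
      h (p.1, C k l / C k k * p.1 + q^-1 * (Num.sqrt q * p.2))%R)) => //.
    apply: (measurableT_comp mh); apply: measurable_fun_pair => //.
    apply: measurable_funD; apply: measurable_funM => //.
    exact: measurable_funM.
  transitivity (\int[P]_w g (X k w)).
    by apply: eq_integral => w _; rewrite /g /h'/= tnth_mktuple -kE.
  rewrite (ge0_integral_marginal1 k pdC hX mg); last by move=> x;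
    exact: integral_ge0.
  have sq0 : (0 < Num.sqrt q)%R by rewrite sqrtr_gt0.
  have sC0 : (0 < Num.sqrt (C k k))%R by rewrite sqrtr_gt0.
  apply: eq_integral => x _; apply: eq_integral => z _; congr (h (_, _ + _))%R.
    rewrite -[X in (_ / X)%R](sqr_sqrtr (ltW C0)); field; rewrite gt_eqF//.
  rewrite vq sqrtrV ?ltW// mulrA; congr (_ * _)%R.
  by rewrite -[X in (X^-1)%R](sqr_sqrtr (ltW q0)); field; rewrite gt_eqF.
- have [i /andP[ik il]] := ord_avoid2 k l.
  have [k' kE] := lift_neq ik; have [l' lE] := lift_neq il.
  have kl' : k' != l' by apply: contraNneq kl => kl'; rewrite kE lE kl'.
  have := IH _ _ k' l' (posdef_minor i pdC)
    (has_density_minor i pdC hX) kl' mh h0.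
  by rewrite !minor_mxE -kE -lE.
Qed.
End marginals.

(** * The score of a Gaussian density *)

Section gradient_log.
Context {R : realType} {K : nat}.

(** Along a line the logarithm of the density is a quadratic polynomial, whose
    difference quotients are affine. *)
Lemma gradient_log_gaussian (C : 'M[R]_K) (x : 'cV[R]_K) (l : 'I_K) :
  posdefmx C ->
  gradient (fun y => ln (gaussian_pdf C y)) x l ord0 = - (invmx C *m x) l ord0.
Proof.
move=> pdC; rewrite mxE.
pose c := (Num.sqrt ((2 * pi) ^+ K * \det C))^-1.
have c0 : 0 < c.
  rewrite invr_gt0 sqrtr_gt0 mulr_gt0 ?posdef_det_gt0//.
  by rewrite exprn_gt0// mulr_gt0// pi_gt0.
pose Q := invmx C; have sQ : Q^T = Q by exact: trmx_inv_sym pdC.1.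
have fE y : ln (gaussian_pdf C y) = ln c - bform Q y y / 2.
  by rewrite /gaussian_pdf -/c lnM ?posrE ?expR_gt0// expRK /bform mulNr.
pose e : 'cV[R]_K := delta_mx l ord0.
have eE : bform Q e x = (Q *m x) l ord0.
  by rewrite /bform -mulmxA trmx_delta -rowE mxE.
rewrite /derive; apply: cvg_lim => //.
apply: (@cvg_trans _ ((fun h : R => - (Q *m x) l ord0 - h * Q l l / 2) @ 0^')).
  apply: near_eq_cvg; near=> h.
  have h0 : h != 0 by near: h; exact: nbhs_dnbhs_neq.
  rewrite /= !fE bformDl !bformDr !bformZl !bformZr (bformC x e sQ) eE.
  rewrite bform_delta /GRing.scale/=.
  by field.
apply: cvg_within_filter.
have : (fun h : R => - (Q *m x) l ord0 - h * (Q l l / 2)) h @[h --> 0] -->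
    - (Q *m x) l ord0 - 0 * (Q l l / 2).
  apply: (@cvgB _ R^o); first exact: cvg_cst.
  by apply: cvgMl; exact: cvg_id.
rewrite mul0r subr0; under eq_fun do rewrite mulrA.
exact.
Unshelve. all: by end_near. Qed.
End gradient_log.

(** * Rank scores of a Gaussian vector *)

Section gaussian_scores.
Context {R : realType}.
Local Notation B := (measurableTypeR R).
Local Notation gamma := (@normal_prob R 0 1).
Context {d : measure_display} {T : measurableType d} (P : probability T R).
Local Open Scope ereal_scope.

Lemma integrable_bounded (f : T -> R) (M : R) : measurable_fun [set: T] f ->
  (forall w, `|f w| <= M)%R -> P.-integrable [set: T] (EFin \o f).
Proof.
move=> mf fM; apply: measurable_bounded_integrable => //.
  by rewrite (le_lt_trans (probability_le1 P measurableT))// ltry.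
exists M; split; first exact: num_real.
by move=> y My w _; exact: le_trans (fM w) (ltW My).
Qed.

Variables (n : nat) (X : 'I_n.+1 -> {RV P >-> R}) (C : 'M[R]_n.+1).
Variable (sigma : 'I_n.+1 -> R).
Hypotheses (pdC : posdefmx C) (hX : has_density X (gaussian_pdf C)).
Hypothesis hsigma : forall k, (0 < sigma k)%R /\ C k k = (sigma k ^+ 2)%R.

Let s0 k : (0 < sigma k)%R. Proof. by have [] := hsigma k. Qed.
Let sqrtC k : (Num.sqrt (C k k) = sigma k)%R.
Proof. by have [? ->] := hsigma k; rewrite sqrtr_sqr gtr0_norm. Qed.

(** The basis of linear forms dual to the coordinates for the covariance:
    [Cov (X_k, dual_coord l) = (k == l)]. *)
Definition dual_coord (l : 'I_n.+1) (w : T) : R :=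
  (invmx C *m \col_k X k w) l ord0.

Lemma measurable_dual_coord l : measurable_fun [set: T] (dual_coord l).
Proof.
rewrite (_ : dual_coord l = (fun t =>
  (invmx C *m tuple_col t) l ord0) \o rvec X).
  exact: (measurableT_comp (measurable_linear_form _ _) (measurable_rvec X)).
apply/funext => w; rewrite /dual_coord /=; congr ((_ *m _) _ _).
by apply/matrixP => i j; rewrite !mxE tnth_mktuple.
Qed.

Lemma integrable_dual_coord l : P.-integrable [set: T] (EFin \o dual_coord l).
Proof.
apply/integrableP; split; first by apply/measurable_EFinP;
  exact: measurable_dual_coord.
pose h (p : n.-tuple B * R) := `|p.2|%:E.
have mh : measurable_fun [set: n.-tuple B * R] h.
  by apply/measurable_EFinP; apply: measurableT_comp => //;
    exact: measurable_snd.
have h0 p : 0 <= h p by rewrite lee_fin.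
have := ge0_integral_residual l pdC hX mh h0.
rewrite /h/= => e.
rewrite (_ : \int[P]_x _ = \int[P]_w (`|dual_coord l w|)%:E)// e.
set q := invmx C l l.
have -> : \int[gamma]_z `|Num.sqrt q * z|%:E =
  (Num.sqrt q)%:E * \int[gamma]_z `|z|%:E.
  rewrite -ge0_integralZl//; last first.
    by apply/measurable_EFinP; exact: normr_measurable.
  apply: eq_integral => z _; rewrite -EFinM normrM ger0_norm//.
rewrite integral_cst; last exact: measurableT.
rewrite [X in _ * X](probability_setT P) mule1.
rewrite lte_mul_pinfty ?lee_fin// ?integral_std_abs_lty//.
Qed.

(** By [ge0_integral_residual] and the symmetry of the normal distribution,
    the positive and negative parts of the product have the same integral. *)
Lemma integral_mul_dual_coord0 k l (g : R -> R) (M : R) : k != l ->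
  measurable_fun [set: R] g -> (forall x, `|g x| <= M)%R ->
  \int[P]_w (g (X k w) * dual_coord l w)%:E = 0.
Proof.
move=> kl mg gM; have [j kE] : exists j, k = lift l j by apply: lift_neq;
  rewrite eq_sym.
pose f (p : n.-tuple B * R) : \bar R := (g (tnth p.1 j) * p.2)%:E.
have mf : measurable_fun [set: n.-tuple B * R] f.
  apply/measurable_EFinP/measurable_funM; last exact: measurable_snd.
  apply: (measurableT_comp mg); apply: (measurableT_comp (measurable_tnth j)).
  exact: measurable_fst.
have fE w : (g (X k w) * dual_coord l w)%:E =
    f (rvec (fun j => X (lift l j)) w, dual_coord l w).
  by rewrite /f/= tnth_mktuple kE.
have intf : P.-integrable [set: T] (fun w => (g (X k w) * dual_coord l w)%:E).
  apply: (@integrableMr _ _ _ P setT measurableT (fun w => g (X k w))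
    (EFin \o dual_coord l)).
  - by apply: (measurableT_comp mg); exact: (measurable_funPT (X k)).
  - exists M; split; first exact: num_real.
    by move=> y My w _; exact: le_trans (gM _) (ltW My).
  - exact: integrable_dual_coord.
rewrite integralE.
have -> : \int[P]_w (fun w => (g (X k w) * dual_coord l w)%:E)^\+ w =
    \int[P]_w (fun w => (g (X k w) * dual_coord l w)%:E)^\- w.
  have := ge0_integral_residual l pdC hX (measurable_funepos mf)
    (funepos_ge0 f).
  have := ge0_integral_residual l pdC hX (measurable_funeneg mf)
    (funeneg_ge0 f).
  set q := invmx C l l => en ep.
  transitivity (\int[P]_w f^\+ (rvec (fun j => X
    (lift l j)) w, dual_coord l w)).
    by apply: eq_integral => w _; rewrite !funeposE fE.
  transitivity (\int[P]_w f^\- (rvec (fun j => X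
    (lift l j)) w, dual_coord l w)); last first.
    by apply: eq_integral => w _; rewrite !funenegE fE.
  rewrite ep en; apply: eq_integral => w _.
  rewrite -ge0_integral_std_opp.
  - apply: eq_integral => z _; rewrite funeposE funenegE /f/=.
    by rewrite mulrN mulrN EFinN.
  - apply: (measurableT_comp (measurable_funepos mf));
      apply: measurable_fun_pair; first exact: measurable_cst.
    exact: measurable_funM.
  - by move=> z; exact: funepos_ge0.
apply: subee; exact: (integrable_fin_num measurableT
  (integrable_funeneg measurableT intf)).
Qed.

Lemma cdf_transformE k w : cdf_transform X k w = std_cdf (X k w / sigma k).
Proof.
rewrite /cdf_transform;
  have -> : cdf (X k) (X k w) = (std_cdf (X k w / sigma k))%:E; last by [].
set r := X k w; pose A : set R := `]-oo, r]%classic.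
have mA : measurable A by exact: measurable_itv.
have m1 : measurable_fun [set: R] (fun x => (\1_A x)%:E : \bar R).
  by apply/measurable_EFinP; exact: measurable_indic.
have p1 x : 0 <= (\1_A x)%:E :> \bar R by rewrite lee_fin indicE ler0n.
have := ge0_integral_marginal1 k pdC hX m1 p1; rewrite sqrtC => e.
have mX : measurable (X k @^-1` A).
  by rewrite -[X in measurable X]setTI; apply: (measurable_funPT (X k)).
have -> : cdf (X k) r = \int[P]_w (\1_A (X k w))%:E.
  transitivity (P (X k @^-1` A `&` setT)); first by rewrite setIT.
  by rewrite -integral_indic.
rewrite e -normal_prob_Nyc -[RHS]/(gamma _) -[X in gamma X]setIT
  -integral_indic; last first.
- exact: measurable_itv.
- exact: measurableT.
apply: eq_integral => z _; rewrite !indicE !mem_setE !in_itv/=.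
by rewrite ler_pdivlMr// mulrC.
Qed.

Lemma measurable_cdf_transform k : measurable_fun [set: T] (cdf_transform X k).
Proof.
rewrite (_ : cdf_transform X k = @std_cdf R \o (fun w => X k w / sigma k)%R);
  last first.
  by apply/funext => w; rewrite cdf_transformE.
apply: (measurableT_comp (@measurable_std_cdf R)); apply: measurable_funM => //.
Qed.

Lemma cdf_transform_bound k w : (0 <= cdf_transform X k w <= 1)%R.
Proof. by rewrite cdf_transformE std_cdf_ge0 std_cdf_le1. Qed.

Let integrable_cdf k : P.-integrable [set: T] (EFin \o cdf_transform X k).
Proof.
apply: (@integrable_bounded _ 1%R); first exact: measurable_cdf_transform.
by move=> w; have /andP[? ?] := cdf_transform_bound k w; rewrite ger0_norm.
Qed.

Let integrable_cdfM k l : P.-integrable [set: T]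
  (EFin \o (cdf_transform X k \* cdf_transform X l)%R).
Proof.
apply: (@integrable_bounded _ 1%R).
  by apply: measurable_funM; exact: measurable_cdf_transform.
move=> w; have /andP[? ?] := cdf_transform_bound k w.
have /andP[? ?] := cdf_transform_bound l w.
by rewrite /= ger0_norm ?mulr_ge0// mulr_ile1.
Qed.

Let mcdf : measurable_fun [set: R] (@std_cdf R).
Proof. exact: measurable_std_cdf. Qed.

Lemma expectation_cdf_transform k : \int[P]_w (cdf_transform X k w)%:E =
  (1 / 2)%:E.
Proof.
rewrite -integral_std_cdf.
pose h (x : R) := (std_cdf (x / sigma k))%:E.
have mh : measurable_fun [set: R] h.
  by apply/measurable_EFinP; apply: (measurableT_comp mcdf);
    exact: measurable_funM.
have h0 x : 0 <= h x by rewrite lee_fin std_cdf_ge0.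
have := ge0_integral_marginal1 k pdC hX mh h0; rewrite sqrtC => e.
transitivity (\int[P]_w h (X k w)).
  by apply: eq_integral => w _; rewrite cdf_transformE.
rewrite e; apply: eq_integral => z _; rewrite /h; congr (std_cdf _)%:E.
by rewrite mulrAC mulfV ?mul1r// gt_eqF.
Qed.

(** In units of the standard deviations, [X_l] given [X_k = x] is normal with
    mean [rho x] and variance [1 - rho^2]; averaging its distribution function
    gives the distribution function at [rho x / sqrt (2 - rho^2)]. *)
Lemma expectation_cdf_transformM k l :
  \int[P]_w (cdf_transform X k w * cdf_transform X l w)%:E =
  (1 / 4 + asin (C k l / (2 * sigma k * sigma l)) / (2 * pi))%:E.
Proof.
have sk := s0 k; have sl := s0 l.
have [<-{l sl}|kl] := eqVneq k l.
  pose h (x : R) := (std_cdf (x / sigma k) * std_cdf (1 * (x / sigma k)))%:E.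
  have mh : measurable_fun [set: R] h.
    apply/measurable_EFinP; apply: measurable_funM;
      apply: (measurableT_comp mcdf).
      exact: measurable_funM.
    by apply: measurable_funM => //; exact: measurable_funM.
  have h0 x : 0 <= h x by rewrite lee_fin mulr_ge0 ?std_cdf_ge0.
  have := ge0_integral_marginal1 k pdC hX mh h0; rewrite sqrtC => e.
  transitivity (\int[P]_w h (X k w)).
    by apply: eq_integral => w _; rewrite /h mul1r cdf_transformE.
  rewrite e; have := integral_std_cdfM (1 : R).
  have -> : (1 / (Num.sqrt 2 * Num.sqrt (1 + 1 ^+ 2)) = C k k /
    (2 * sigma k * sigma k) :> R)%R.
    have [_ ->] := hsigma k; rewrite expr1n (_ : 1 + 1 = 2)%R; last by ring.
    by rewrite -expr2 sqr_sqrtr//; field; rewrite gt_eqF.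
  move=> <-; apply: eq_integral => z _; rewrite /h.
  by rewrite [(sigma k * z / _)%R]mulrAC mulfV ?mul1r// gt_eqF.
pose h (p : R * R) := (std_cdf (p.1 / sigma k) * std_cdf (p.2 / sigma l))%:E.
have mh : measurable_fun [set: R * R] h.
  apply/measurable_EFinP; apply: measurable_funM;
    apply: (measurableT_comp mcdf).
    by apply: measurable_funM => //; exact: measurable_fst.
  by apply: measurable_funM => //; exact: measurable_snd.
have h0 x : 0 <= h x by rewrite lee_fin mulr_ge0 ?std_cdf_ge0.
have := ge0_integral_marginal2 pdC hX kl mh h0; rewrite sqrtC => e.
transitivity (\int[P]_w h (X k w, X l w)).
  by apply: eq_integral => w _; rewrite /h !cdf_transformE.
rewrite e; pose rho := (C k l / (sigma k * sigma l))%R.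
have [_ Ck] := hsigma k; have [_ Cl] := hsigma l.
pose v := (C l l - C k l ^+ 2 / C k k)%R.
have v0 : (0 <= v)%R.
  rewrite /v subr_ge0 ler_pdivrMr; last by rewrite Ck exprn_gt0.
  by rewrite mulrC posdef_entry_sqr_le.
have vE : (1 + (Num.sqrt v / sigma l) ^+ 2 = 2 - rho ^+ 2)%R.
  rewrite exprMn sqr_sqrtr// /v /rho Ck Cl; field; rewrite !gt_eqF//.
have t2 : (0 < 2 - rho ^+ 2)%R by rewrite -vE ltr_pwDl// sqr_ge0.
have t0 : (0 < Num.sqrt (2 - rho ^+ 2))%R by rewrite sqrtr_gt0.
have tt : (Num.sqrt (2 - rho ^+ 2) ^+ 2 =
  2 - rho ^+ 2)%R by rewrite sqr_sqrtr// ltW.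
pose c := (rho / Num.sqrt (2 - rho ^+ 2))%R.
have -> : (C k l / (2 * sigma k * sigma l) = c / (Num.sqrt 2 * Num.sqrt
  (1 + c ^+ 2)))%R.
  have r2 : (0 < Num.sqrt 2 :> R)%R by rewrite sqrtr_gt0.
  have -> : (1 + c ^+ 2 = 2 / Num.sqrt (2 - rho ^+ 2) ^+ 2)%R.
    rewrite /c expr_div_n tt; field; rewrite gt_eqF//.
  rewrite sqrtrM// sqrtrV ?sqr_ge0// sqrtr_sqr gtr0_norm// mulrA -expr2
    sqr_sqrtr//.
  by rewrite /c /rho; move: (Num.sqrt (2 - _)) t0 => t t0; field;
    rewrite !gt_eqF.
rewrite -integral_std_cdfM; apply: eq_integral => x _.
transitivity (\int[gamma]_z ((std_cdf x)%:E * (std_cdf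
  (rho * x + Num.sqrt v / sigma l * z))%:E)).
  apply: eq_integral => z _; rewrite /h/= -EFinM;
    congr (std_cdf _ * std_cdf _)%:E.
    by rewrite mulrAC mulfV ?mul1r// gt_eqF.
  by rewrite /rho -/v; field; rewrite !gt_eqF.
rewrite ge0_integralZl; [|exact: measurableT| | |]; first last.
- by rewrite lee_fin std_cdf_ge0.
- by move=> z _; rewrite lee_fin std_cdf_ge0.
- apply/measurable_EFinP; apply: (measurableT_comp mcdf).
  by apply: measurable_funD => //; exact: measurable_funM.
rewrite integral_std_cdf_affine vE -EFinM; congr (_ * std_cdf _)%:E.
by rewrite /c mulrAC.
Qed.

Lemma covariance_cdf_transform k l :
  covariance P (cdf_transform X k) (cdf_transform X l) =
  (asin (C k l / (2 * sigma k * sigma l)) / (2 * pi))%:E.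
Proof.
rewrite covarianceE; [|exact/Lfun1_integrable/integrable_cdf
  |exact/Lfun1_integrable/integrable_cdf|exact/Lfun1_integrable/integrable_cdfM].
rewrite unlock !expectation_cdf_transform expectation_cdf_transformM.
by rewrite -EFinM -EFinB; congr EFin; move: (asin _ / _)%R => a; field.
Qed.
End gaussian_scores.

(** * The rank covariance matrix *)

Lemma integral_bilinear (R : realType) (d : measure_display)
  (T : measurableType d)
    (P : probability T R) (I : finType) (a b : I -> T -> R) (v u : I -> R) :
  (forall k l, P.-integrable [set: T] (fun w => (a k w * b l w)%:E)) ->
  (\int[P]_w ((\sum_k v k * a k w) * (\sum_l u l * b l w))%:E =
  (\sum_k \sum_l v k * u l * fine (\int[P]_w (a k w * b l w)%:E))%:E)%E.
Proof.
move=> iab; have int k l : P.-integrable [set: T]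
    (fun w => (v k * u l)%:E * (a k w * b l w)%:E)%E.
  exact: integrableZl.
transitivity (\int[P]_w (\sum_k \sum_l (v k * u l)%:E * (a k w * b l w)%:E))%E.
  apply: eq_integral => w _.
  rewrite big_distrl/= -sumEFin; apply: eq_bigr => k _.
  rewrite big_distrr/= -sumEFin; apply: eq_bigr => l _.
  by rewrite -EFinM mulrACA.
rewrite integral_sum//; last first.
  by move=> k; apply: integrable_sum => // l _; exact: int.
rewrite -sumEFin; apply: eq_bigr => k _; rewrite integral_sum//.
rewrite -sumEFin; apply: eq_bigr => l _; rewrite integralZl//.
by rewrite -[in LHS](fineK (integrable_fin_num measurableT (iab k l))) -EFinM.
Qed.

Section rank_covariance.
Context {R : realType}.
Local Notation gamma := (@normal_prob R 0 1).
Context {d : measure_display} {T : measurableType d} (P : probability T R).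
Local Open Scope ereal_scope.
Variables (n : nat) (X : 'I_n.+1 -> {RV P >-> R}) (C : 'M[R]_n.+1).
Variable (sigma : 'I_n.+1 -> R).
Hypotheses (pdC : posdefmx C) (hX : has_density X (gaussian_pdf C)).
Hypothesis hsigma : forall k, (0 < sigma k)%R /\ C k k = (sigma k ^+ 2)%R.

Let s0 k : (0 < sigma k)%R. Proof. by have [] := hsigma k. Qed.
Let sqrtC k : (Num.sqrt (C k k) = sigma k)%R.
Proof. by have [? ->] := hsigma k; rewrite sqrtr_sqr gtr0_norm. Qed.

Definition centered_rank k (w : T) : R := (cdf_transform X k w - 1 / 2)%R.

Let rank_score k (x : R) : R := (std_cdf (x / sigma k) - 1 / 2)%R.

Let rank_scoreE k w : centered_rank k w = rank_score k (X k w).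
Proof. by rewrite /centered_rank (cdf_transformE pdC hX hsigma). Qed.

Let measurable_rank_score k : measurable_fun [set: R] (rank_score k).
Proof.
apply: measurable_funB => //; apply: (measurableT_comp (@measurable_std_cdf R)).
exact: measurable_funM.
Qed.

Let rank_score_le k x : (`|rank_score k x| <= 1)%R.
Proof.
have := std_cdf_ge0 (x / sigma k); have := std_cdf_le1 (x / sigma k).
by rewrite /rank_score ler_norml => ? ?; apply/andP; split; lra.
Qed.

Lemma measurable_centered_rank k : measurable_fun [set: T] (centered_rank k).
Proof.
by apply: measurable_funB => //;
  exact: (measurable_cdf_transform pdC hX hsigma).
Qed.

Lemma centered_rank_le k w : (`|centered_rank k w| <= 1)%R.
Proof. by rewrite rank_scoreE. Qed.

Lemma integrable_rank_dual_coord k l : P.-integrable [set: T]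
  (fun w => (centered_rank k w * dual_coord X C l w)%:E).
Proof.
apply: (@integrableMr _ _ _ P setT measurableT (centered_rank k)
  (EFin \o dual_coord X C l)).
- exact: measurable_centered_rank.
- exists 1%R; split; first exact: num_real.
  by move=> y My w _; exact: le_trans (centered_rank_le k w) (ltW My).
- exact: integrable_dual_coord.
Qed.

Lemma integral_rank_dual_coord0 k l : k != l ->
  \int[P]_w (centered_rank k w * dual_coord X C l w)%:E = 0.
Proof.
move=> kl.
rewrite -(integral_mul_dual_coord0 pdC hX kl (measurable_rank_score k)
  (rank_score_le k)).
by apply: eq_integral => w _; rewrite rank_scoreE.
Qed.

(** As [X_k = \sum_l C_kl * dual_coord l], only the term [l = k] contributes to
    the mean of [centered_rank k * X_k], which depends on the law of [X_k]
    alone. *)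
Lemma integral_rank_dual_coord_diag k :
  \int[P]_w (centered_rank k w * dual_coord X C k w)%:E =
  ((2 * Num.sqrt pi)^-1 / sigma k)%:E.
Proof.
have sk := s0 k.
pose h (x : R) := (sigma k * ((x / sigma k) ^+ 2 * mean_pdf (x / sigma k)))%:E.
have mdiv : measurable_fun [set: R] (fun x =>
  x / sigma k)%R by exact: measurable_funM.
have mh : measurable_fun [set: R] h.
  apply/measurable_EFinP; apply: measurable_funM => //; apply: measurable_funM.
    exact: measurable_funX.
  by apply: (measurableT_comp (@measurable_mean_pdf R)).
have h0 x : 0 <= h x.
  by rewrite lee_fin; apply: mulr_ge0;
    [exact: ltW|rewrite mulr_ge0 ?sqr_ge0 ?mean_pdf_ge0].
have := ge0_integral_marginal1 k pdC hX mh h0; rewrite sqrtC => e1.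
have e2 : \int[P]_w h (X k w) = (sigma k / (2 * Num.sqrt pi))%:E.
  rewrite e1 EFinM -integral_std_sqr_mean_pdf.
  transitivity (\int[gamma]_z ((sigma k)%:E * (z ^+ 2 * mean_pdf z)%:E)).
    apply: eq_integral => z _; rewrite /h -EFinM [(sigma k * z / _)%R]mulrAC.
    by rewrite mulfV ?mul1r// gt_eqF.
  apply: ge0_integralZl; [exact: measurableT| |
    by move=> z _; rewrite lee_fin mulr_ge0 ?sqr_ge0 ?mean_pdf_ge0|by rewrite
      lee_fin ltW].
  apply/measurable_EFinP; apply: measurable_funM; first exact: measurable_funX.
  exact: measurable_mean_pdf.
have e3 : \int[P]_w h (X k w) =
    \int[P]_w (\sum_l (C k l)%:E * (centered_rank k w * dual_coord X C l w)%:E).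
  apply: eq_integral => w _; rewrite sumEFin /h; congr EFin.
  have xE : (X k w = \sum_l C k l * dual_coord X C l w)%R.
    have := mulKVmx (posdef_unitmx pdC) (\col_k X k w) => /matrixP/(_ k ord0).
    by rewrite mxE [RHS]mxE => <-; apply: eq_bigr.
  transitivity (centered_rank k w * X k w)%R.
    rewrite rank_scoreE /rank_score /std_cdf; field; rewrite gt_eqF//.
  by rewrite xE big_distrr/=; apply: eq_bigr => l _; rewrite mulrCA.
have int l := integrable_rank_dual_coord k l.
move: e2; rewrite e3 integral_sum//; last by move=> l; exact: integrableZl.
rewrite (bigD1 k)//= big1 ?adde0; last first.
  by move=> l lk; rewrite integralZl// integral_rank_dual_coord0 ?mule0//
    eq_sym.
rewrite integralZl// -(fineK (integrable_fin_num measurableT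
  (int k))) -EFinM => -[e].
congr EFin; have [_ Ck] := hsigma k.
apply: (mulfI (lt0r_neq0 (posdef_diag_gt0 k pdC))); rewrite e Ck.
have p0 : (0 < Num.sqrt pi :> R)%R by rewrite sqrtr_gt0 pi_gt0.
by move: (Num.sqrt pi) p0 => p p0; field; rewrite !gt_eqF.
Qed.

Lemma rank_cov_mxE k l :
  rank_cov_mx X k l = (2 / pi * asin (C k l / (2 * sigma k * sigma l)))%R.
Proof.
rewrite mxE (covariance_cdf_transform pdC hX hsigma)/=.
have p0 : (0 < pi :> R)%R := pi_gt0 R.
by move: (pi : R) p0 (asin _) => p p0 a; field; rewrite gt_eqF.
Qed.

Let integrable_rank2 k l : P.-integrable [set: T]
  (fun w => (centered_rank k w * centered_rank l w)%:E).
Proof.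
apply: (@integrable_bounded _ _ _ P (fun w =>
  centered_rank k w * centered_rank l w)%R 1%R).
  by apply: measurable_funM; exact: measurable_centered_rank.
by move=> w; rewrite normrM mulr_ile1// centered_rank_le.
Qed.

Let rank_cov_integral k l :
  (rank_cov_mx X k l)%:E = 4%:E * \int[P]_w
    (centered_rank k w * centered_rank l w)%:E.
Proof.
rewrite mxE EFinM; congr (_ * _).
have e : covariance P (cdf_transform X k) (cdf_transform X l) =
    \int[P]_w (centered_rank k w * centered_rank l w)%:E.
  rewrite unlock unlock !(expectation_cdf_transform pdC hX hsigma).
  by [].
by rewrite e fineK//; exact: integrable_fin_num.
Qed.

(** The form at [v] is four times the second moment of
    [Y = \sum_k v_k centered_rank k]. If it vanishes then [Y = 0] almost surely,
    which contradicts the value of the mean of [Y * \sum_l v_l dual_coord l],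
    a positive combination of the [v_k ^+ 2]. *)
Lemma posdef_rank_cov_mx : posdefmx (rank_cov_mx X).
Proof.
have symS : (rank_cov_mx X)^T = rank_cov_mx X.
  by apply/matrixP => k l;
    rewrite mxE !rank_cov_mxE -[in LHS]pdC.1 mxE [(2 * sigma l * _)%R]mulrAC.
split=> // v v0; rewrite -/(bform _ _ _).
pose Y w := (\sum_k v k ord0 * centered_rank k w)%R.
pose V w := (\sum_l v l ord0 * dual_coord X C l w)%R.
have YY : \int[P]_w (Y w * Y w)%:E = (bform (rank_cov_mx X) v v / 4)%:E.
  rewrite (integral_bilinear (fun k => v k ord0) (fun k =>
    v k ord0) integrable_rank2) bformE mulr_suml; congr EFin.
  apply: eq_bigr => k _; rewrite mulr_suml; apply: eq_bigr => l _.
  have [->] : (rank_cov_mx X k l)%:E =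
      (4 * fine (\int[P]_w (centered_rank k w * centered_rank l w)%:E))%:E.
    rewrite EFinM fineK ?rank_cov_integral//.
    exact: (integrable_fin_num measurableT (integrable_rank2 k l)).
  by move: (fine _) => r; field.
have YV : \int[P]_w (Y w * V w)%:E =
    (\sum_k v k ord0 ^+ 2 * ((2 * Num.sqrt pi)^-1 / sigma k))%:E.
  rewrite (integral_bilinear (fun k => v k ord0) (fun k =>
    v k ord0) integrable_rank_dual_coord); congr EFin.
  apply: eq_bigr => k _; rewrite (bigD1 k)//= big1 ?addr0; last first.
    by move=> l lk; rewrite integral_rank_dual_coord0 ?mulr0// eq_sym.
  by rewrite integral_rank_dual_coord_diag.
have mY : measurable_fun [set: T] Y.
  apply: measurable_sum => k; apply: measurable_funM => //.
  exact: measurable_centered_rank.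
have mV : measurable_fun [set: T] V.
  apply: measurable_sum => l; apply: measurable_funM => //.
  exact: measurable_dual_coord.
have YY0 : 0 <= \int[P]_w (Y w * Y w)%:E.
  by apply: integral_ge0 => w _; rewrite lee_fin -expr2 sqr_ge0.
rewrite lt_neqAle; apply/andP; split; last first.
  by move: YY0; rewrite YY lee_fin pmulr_lge0// invr_gt0.
apply/eqP => b0; move: YY; rewrite -b0 mul0r => YY.
have mYY : measurable_fun [set: T] (fun w => (Y w * Y w)%:E).
  by apply/measurable_EFinP; exact: measurable_funM.
have aeY : ae_eq P [set: T] (fun w => (Y w * Y w)%:E) (cst 0).
  apply/(ae_eq_integral_abs P measurableT mYY); apply: etrans YY;
    apply: eq_integral => w _.
  by rewrite gee0_abs// lee_fin -expr2 sqr_ge0.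
have : \int[P]_w (Y w * V w)%:E = 0.
  rewrite -(integral0 P [set: T]); apply: ae_eq_integral;
    [exact: measurableT| | |].
  - by apply/measurable_EFinP; exact: measurable_funM.
  - exact: measurable_cst.
  - apply: filterS aeY => w h Tw; have := h Tw => /= -[/eqP].
    by rewrite mulf_eq0 orbb => /eqP ->; rewrite mul0r.
rewrite YV => -[] /eqP; rewrite gt_eqF//.
have c0 k : (0 < (2 * Num.sqrt pi)^-1 / sigma k)%R.
  by rewrite divr_gt0// invr_gt0 mulr_gt0// sqrtr_gt0 pi_gt0.
rewrite lt_neqAle; apply/andP; split; last first.
  by apply: sumr_ge0 => k _; rewrite mulr_ge0 ?sqr_ge0// ltW.
apply: contra v0; rewrite eq_sym => /eqP/psumr_eq0P z; apply/eqP/matrixP => k j.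
rewrite (ord1 j) mxE; apply/eqP; rewrite -sqrf_eq0.
have := z (fun k _ => mulr_ge0 (sqr_ge0 _) (ltW (c0 k))) k isT => /eqP.
by rewrite mulf_eq0 (gt_eqF (c0 k)) orbF.
Qed.
End rank_covariance.

(** * The asymptotic relative efficiency *)

Section gaussian_efficiency.
Context {R : realType} {n : nat}.
Context {d : measure_display} {T : measurableType d} (P : probability T R).
Variables (X : 'I_n.+1 -> {RV P >-> R}) (C : 'M[R]_n.+1).
Variable (sigma : 'I_n.+1 -> R).
Hypotheses (pdC : posdefmx C) (hX : has_density X (gaussian_pdf C)).
Hypothesis hsigma : forall k, 0 < sigma k /\ C k k = sigma k ^+ 2.

Lemma score_productE w k l :
  score_product X (gaussian_pdf C) w k l =
  - (centered_rank X k w * dual_coord X C l w).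
Proof.
by rewrite mxE big_ord1 mxE [_^T _ _]mxE gradient_log_gaussian// mulrN.
Qed.

Lemma integrable_score_product k l : P.-integrable [set: T]
  (fun w => (score_product X (gaussian_pdf C) w k l)%:E).
Proof.
rewrite (_ : (fun _ => _) =
    (fun w => (-1)%:E * (centered_rank X k w * dual_coord X C l w)%:E)%E).
  by apply: integrableZl => //;
    exact: (integrable_rank_dual_coord pdC hX hsigma).
by apply/funext => w; rewrite score_productE -EFinM mulN1r.
Qed.

Lemma score_mx_gaussian : score_mx X (gaussian_pdf C) =
  - (2 * Num.sqrt pi)^-1 *: diag_mx (\row_k (sigma k)^-1).
Proof.
apply/matrixP => k l; rewrite !mxE unlock.
have -> : (\int[P]_w (score_product X (gaussian_pdf C) w k l)%:E =
    (-1)%:E * \int[P]_w (centered_rank X k w * dual_coord X C l w)%:E)%E.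
  rewrite -integralZl//; last exact: (integrable_rank_dual_coord pdC hX hsigma).
  by apply: eq_integral => w _; rewrite score_productE -EFinM mulN1r.
have [<-|kl] := eqVneq k l.
  by rewrite (integral_rank_dual_coord_diag pdC hX hsigma)/= mulN1r mulNr.
by rewrite (integral_rank_dual_coord0 pdC hX hsigma kl) mule0 mulr0n mulr0.
Qed.

(** [2 / pi * (pi / 3) * (|C_kl| / (2 sigma_k sigma_l))] is the bound of
    [asin_norm_le], which applies because [|C_kl| <= sigma_k sigma_l]. *)
Lemma rank_cov_mx_le k l :
  `|rank_cov_mx X k l| <= `|C k l| / (3 * sigma k * sigma l).
Proof.
have [sk Ck] := hsigma k; have [sl Cl] := hsigma l.
have pi0 : 0 < pi :> R := pi_gt0 R.
have CS : `|C k l| <= sigma k * sigma l.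
  have ss : 0 <= sigma k * sigma l by rewrite mulr_ge0 ?ltW.
  rewrite -(ler_pXn2r (n := 2))// real_normK ?num_real// exprMn -Ck -Cl.
  exact: posdef_entry_sqr_le.
have xE : `|C k l / (2 * sigma k * sigma l)| = `|C k l| /
  (2 * sigma k * sigma l).
  by rewrite normrM normfV [`|_ * sigma l|]gtr0_norm// !mulr_gt0.
have h : `|C k l / (2 * sigma k * sigma l)| <= 1 / 2.
  rewrite xE ler_pdivrMr ?mulr_gt0//.
  by rewrite (_ : 1 / 2 * _ = sigma k * sigma l)//; field.
rewrite (rank_cov_mxE pdC hX hsigma) normrM gtr0_norm ?divr_gt0//.
apply: le_trans (ler_wpM2l _ (asin_norm_le h)) _;
  first by rewrite divr_ge0// ltW.
rewrite xE; move: (pi : R) pi0 => p p0.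
by rewrite le_eqVlt; apply/orP; left; apply/eqP; field; rewrite !gt_eqF.
Qed.
End gaussian_efficiency.

(* The minus sign in the value of A: by Stein's identity
   E[(F_k(X_k) - 1/2) (grad (log f) (X))_l] = - E[d_l F_k(X_k)]. *)
Theorem corollary2 (R : realType) (K : nat) (hK : (0 < K)%N)
  (t1 : R) (ht1 : 0 < t1 < 1)
  (C : 'M[R]_K) (hC : posdefmx C)
  (sigma : 'I_K -> R) (hsigma : forall k, 0 < sigma k /\ C k k = sigma k ^+ 2)
  (d : measure_display) (T : measurableType d) (P : probability T R)
  (X : 'I_K -> {RV P >-> R}) (hX : has_density X (gaussian_pdf C)) :
  let A := score_mx X (gaussian_pdf C) in
  let Sigma := rank_cov_mx X in
  [/\ forall k l, P.-integrable [set: T]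
        (fun w => (score_product X (gaussian_pdf C) w k l)%:E),
      A = - (2 * Num.sqrt pi)^-1 *: diag_mx (\row_k (sigma k)^-1),
      forall k l, Sigma k l = 2 / pi * asin (C k l / (2 * sigma k * sigma l)),
      Sigma \in unitmx
    & forall delta : 'cV[R]_K, delta != 0 ->
        noncentrality_rank t1 A Sigma delta / noncentrality_hotelling t1 C delta
        >= 3 / pi * (min_diag C / max_diag C) *
           (min_eigenvalue C / max_eigenvalue (absmx C))].
Proof.
case: K => // n in hK C hC sigma hsigma X hX * => A Sigma.
have SigmaE := rank_cov_mxE hC hX hsigma.
have pdSigma := posdef_rank_cov_mx hC hX hsigma.
split.
- exact: integrable_score_product.
- exact: score_mx_gaussian.
- exact: SigmaE.
- exact: posdef_unitmx.
- move=> delta d0; apply: (efficiency_ge (sigma := sigma)) => //.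
  + exact: rank_cov_mx_le.
  + exact: pdSigma.1.
  + by move=> v; exact: posdef_ge0.
  + exact: posdef_unitmx.
  + exact: score_mx_gaussian.
Qed.
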